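(* Let $q\ge3$ be an integer, suppose that $\beta\ge\beta_s(q)$, and let $r>0$ be a sufficiently small constant (depending only on $\beta$ and $q$). For any $x\in\mathfrak S_{\beta,q}$, let $\widetilde X,\widetilde Y\in\widetilde\Omega(x,r)$ be random configurations on $N$ vertices distributed according to the conditional measures $\tilde\mu$ and $\tilde\nu$ respectively. Then there exists a constant $\theta^*>0$, depending on $\beta$, $q$ and $r$ (and not on $N$), such that for any function $h:\widetilde\Omega(x,r)\to\mathbb R$, $$|\mathbb{E}h(\widetilde X)-\mathbb{E}h(\widetilde Y)|\le\|L(h)\|_\infty\,\theta^*\sqrt N .$$
   Context: $N$ is the number of vertices, $[q]=\{1,\dots,q\}$, $\Omega=[q]^N$. The Curie--Weiss--Potts model is the probability measure $\mu(\sigma)=e^{-\beta H(\sigma)}/Z(\beta)$ on $\Omega$, with $H(\sigma)=-\frac1N\sum_{u,v\in[N]}\mathbf 1_{\{\sigma(u)=\sigma(v)\}}$ (all ordered pairs) and $Z(\beta)$ the normalising constant. Spinodal inverse temperature: $\beta_s(q)=\sup\{\beta\ge0:(1+(q-1)e^{2\beta\frac{1-qx}{q-1}})^{-1}-x\ne0\ \ \forall x\in(1/q,1)\}$. Equilibrium macrostates: $\mathfrak S_{\beta,q}=\arg\min_{s\in\mathbb R^q}G_\beta(s)$ with $G_\beta(s)=\beta\|s\|_2^2-\log\big(\sum_{i=1}^q e^{2\beta s^{(i)}}\big)$. (It is known that these points lie in the probability simplex. With $\beta_c=\frac{(q-1)\log(q-1)}{q-2}$, $\hat e=(1/q,\dots,1/q)$,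 $s_{\beta,q}$ the largest real solution of $s=\frac{1-e^{-2\beta s}}{1+(q-1)e^{-2\beta s}}$, and $\mathbf T^j\check s_{\beta,q}$ the vector with $j$th coordinate $\frac{1+(q-1)s_{\beta,q}}{q}$ and all other coordinates $\frac{1-s_{\beta,q}}{q}$, one has $\mathfrak S_{\beta,q}=\{\hat e\}$ for $0<\beta<\beta_c$, $\{\hat e,\mathbf T^1\check s_{\beta,q},\dots,\mathbf T^q\check s_{\beta,q}\}$ for $\beta=\beta_c$, and $\{\mathbf T^1\check s_{\beta,q},\dots,\mathbf T^q\check s_{\beta,q}\}$ for $\beta>\beta_c$.) For $\sigma\in\Omega$, $S(\sigma)\in\mathbb R^q$ is the vector of proportions $S^{(k)}(\sigma)=\frac1N\#\{j\in[N]:\sigma(j)=k\}$. For $r>0$, $\widetilde\Omega(x,r)=\{\sigma\in\Omega:\|S(\sigma)-x\|_2\le r\}$. Given $x\in\mathfrak S_{\beta,q}$, $\nu$ is the product measure on $\Omega$ under which the colours of the vertices are i.i.d. with $\mathbb P(\text{colour}=k)=x^{(k)}$. $\tilde\mu=\mu(\cdot\mid\widetilde\Omega(x,r))$ and $\tilde\nu=\nu(\cdot\mid\widetilde\Omega(x,r))$. For $h:\widetilde\Omega(x,r)\to\mathbb R$ and $v\in[N]$, $L_v(h)=\sup|h(\sigma)-h(\tau)|$ over all pairs $\sigma,\tau$ in the domain $\widetilde\Omega(x,r)$ with $\sigma(u)=\tau(u)$ for all $u\ne v$, and $\|L(h)\|_\infty=\max_vL_v(h)$. *)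

(* Defs.v *)
From HB Require Import structures.
From mathcomp Require Import all_boot all_order all_algebra.
From mathcomp Require Import all_classical all_reals all_analysis.

Set Implicit Arguments.
Unset Strict Implicit.
Unset Printing Implicit Defensive.

Import Order.TTheory GRing.Theory Num.Theory.

Local Open Scope classical_set_scope.
Local Open Scope ring_scope.

(* The library norm on 'rV[R]_q is the max norm, hence this definition. *)
Definition norm2 (R : realType) (q : nat) (s : 'rV[R]_q) : R :=
  Num.sqrt (\sum_(i < q) s 0 i ^+ 2).

(* For q >= 3 this set of reals is nonempty (it contains 0) and bounded above,
   so [sup] is its genuine least upper bound. *)
Definition beta_s (R : realType) (q : nat) : R :=
  sup [set beta : R | 0 <= beta /\
    forall x : R, q%:R^-1 < x < 1 ->
      (1 + (q%:R - 1) * expR (2 * beta * ((1 - q%:R * x) / (q%:R - 1))))^-1 - x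
        != 0].

Definition free_energy (R : realType) (q : nat) (beta : R) (s : 'rV[R]_q) : R :=
  beta * norm2 s ^+ 2 - ln (\sum_(i < q) expR (2 * beta * s 0 i)).

Definition macrostates (R : realType) (q : nat) (beta : R) : set 'rV[R]_q :=
  [set s | forall t : 'rV[R]_q, free_energy beta s <= free_energy beta t].

Arguments macrostates {R} q beta _.

(* Vertices and colours are numbered from 0. *)
Definition config (N q : nat) : finType := {ffun 'I_N -> 'I_q}.

Definition hamiltonian (R : realType) (N q : nat) (sigma : config N q) : R :=
  - (N%:R^-1 * \sum_(u < N) \sum_(v < N) (sigma u == sigma v)%:R).

Definition partition_function (R : realType) (N q : nat) (beta : R) : R :=
  \sum_(sigma : config N q) expR (- beta * hamiltonian R sigma).

(* Probability measures on a finite type are given by their mass functions. *)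
Definition potts (R : realType) (N q : nat) (beta : R) (sigma : config N q) : R :=
  expR (- beta * hamiltonian R sigma) / partition_function N q beta.

Definition product_measure (R : realType) (N q : nat) (x : 'rV[R]_q)
    (sigma : config N q) : R :=
  \prod_(v < N) x 0 (sigma v).

Definition proportions (R : realType) (N q : nat) (sigma : config N q) : 'rV[R]_q :=
  \row_(k < q) (#|[pred j : 'I_N | sigma j == k]|%:R / N%:R).

Definition near_configs (R : realType) (N q : nat) (x : 'rV[R]_q) (r : R) :
    {set config N q} :=
  finset (fun sigma : config N q => norm2 (proportions R sigma - x) <= r).

(* If p gives A mass zero (in particular if A is empty), division by 0 makes this
   the zero function. *)
Definition conditional (R : realType) (T : finType) (p : T -> R) (A : {set T})
    (t : {t : T | t \in A}) : R :=
  p (val t) / \sum_(u in A) p u.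

Arguments conditional {R T} p A t.

Definition expect (R : realType) (T : finType) (p h : T -> R) : R :=
  \sum_(t : T) p t * h t.

(* The supremum is over a finite set; it is nonempty as soon as A is (take
   sigma = tau), and if A is empty then [sup set0 = 0]. *)
Definition lipschitz_at (R : realType) (N q : nat) (A : {set config N q})
    (h : {sigma : config N q | sigma \in A} -> R) (v : 'I_N) : R :=
  sup [set d : R | exists sigma tau : {sigma : config N q | sigma \in A},
    (forall u : 'I_N, u != v -> val sigma u = val tau u) /\
    d = `|h sigma - h tau|].

(* Each [lipschitz_at h v] is nonnegative, so the default value 0 is harmless. *)
Definition lipschitz_sup (R : realType) (N q : nat) (A : {set config N q})
    (h : {sigma : config N q | sigma \in A} -> R) : R :=
  \big[Num.max/0]_(v < N) lipschitz_at h v.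

(* Main.v *)
Require Import Defs.
From mathcomp Require Import all_boot all_order all_algebra.
From mathcomp Require Import all_fingroup.
From mathcomp Require Import all_classical all_reals all_analysis.
From mathcomp Require Import ring lra zify.

Import Order.TTheory GRing.Theory Num.Theory numFieldNormedType.Exports.

Local Open Scope classical_set_scope.
Local Open Scope ring_scope.

                                                                               
                                                                               
                                                                             
                                                                             
                                                                                
                                                                        
                                                                                
                                                                        
                             
                                                                                
                                                                               
                                                                         
                                                                                
                                                                                
                                                                             
                                                            

                             

(** Write phi = N |S - x|^2. A macrostate x is a fixed point of the softmax map
    ([macrostate_critical]), so completing the square shows that the Potts weight is a constant
    times the product weight times exp(beta phi) ([potts_tilted_weight]). The product measure is the
    same weight with tilt 0, so both conditional measures belong to the family [tilted_weight].

    The ball and these weights are invariant under permutations of the vertices, so h may be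
    replaced by its average over permutations, which depends on the colour counts alone. Two
    configurations of the ball are joined, up to permutation, by one-vertex recolourings that never
    leave the ball, as few as the counts allow ([symmetrise_near_lipschitz]). Hence the two means
    differ by at most L times an average of count differences, and this is of order sqrt N once phi
    has a bounded mean under both conditional measures ([mean_difference_le]).

    That bound, [sq_deviation_moment], comes from a dynamics reversible for the tilted weight. Moves
    inside the ball cancel in the mean increment of phi, and moves out of the ball raise phi, so the
    mean drift of phi is nonnegative ([mean_drift_ge0]). For small r a Taylor expansion ([drift_le])
    bounds the drift at each configuration by a multiple of (constant - (c/2) phi), provided that 2
    b Var_x(d) <= (1 - c) |d|^2 for every d of sum zero.

    For b = beta this proviso says that the Hessian of the free energy at x is positive definite on
    that hyperplane, uniformly in x. It is obtained by comparing x with well chosen points instead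
    of differentiating: one coordinate v of x is at least 1/q and the others are equal
    ([macrostate_shape]), and a comparison with a distant point on the line through x and the
    barycentre makes the second-order condition strict ([macrostate_profile]). Apart from 1/q only
    one v is possible ([macrostate_value_unique]), so c depends on beta and q alone. Positivity of
    beta comes from [beta_s_gt0]. *)

(** * Recolouring one vertex: colour counts and squared deviation *)

Definition recolour (N q : nat) (sigma : config N q) (v : 'I_N) (i : 'I_q) :
    config N q :=
  [ffun u => if u == v then i else sigma u].

Definition colour_count (N q : nat) (sigma : config N q) (k : 'I_q) : nat :=
  #|[pred j : 'I_N | sigma j == k]|.

Definition deviation (R : realType) (N q : nat) (x : 'rV[R]_q)
    (sigma : config N q) (k : 'I_q) : R :=
  (colour_count N q sigma k)%:R / N%:R - x 0 k.

Definition sq_deviation (R : realType) (N q : nat) (x : 'rV[R]_q)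
    (sigma : config N q) : R :=
  \sum_k deviation R N q x sigma k ^+ 2.

Arguments recolour {N q} sigma v i.
Arguments colour_count {N q} sigma k.
Arguments deviation {R N q} x sigma k.
Arguments sq_deviation {R N q} x sigma.

Lemma sum_delta (R : pzRingType) (q : nat) (f : 'I_q -> R) (i : 'I_q) :
  \sum_k f k * (k == i)%:R = f i.
Proof.
rewrite (bigD1 i) //= eqxx mulr1 big1 ?addr0 // => k /negPf ->.
by rewrite mulr0.
Qed.

Lemma colour_countE (N q : nat) (sigma : config N q) (k : 'I_q) :
  colour_count sigma k = (\sum_v (sigma v == k))%N.
Proof. by rewrite /colour_count -sum1_card big_mkcond. Qed.

Lemma sum_colour_count (R : pzRingType) (N q : nat) (sigma : config N q)
    (f : 'I_q -> R) :
  \sum_v f (sigma v) = \sum_k (colour_count sigma k)%:R * f k.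
Proof.
under [RHS]eq_bigr => k _ do rewrite colour_countE natr_sum mulr_suml.
rewrite exchange_big /=; apply: eq_bigr => v _.
rewrite (bigD1 (sigma v)) //= eqxx mul1r big1 ?addr0 // => k.
by rewrite eq_sym => /negPf ->; rewrite mul0r.
Qed.

Lemma sum_colour_count_nat (N q : nat) (sigma : config N q) :
  (\sum_k colour_count sigma k = N)%N.
Proof.
under eq_bigr => k _ do rewrite colour_countE.
rewrite exchange_big /= -[RHS]card_ord -sum1_card; apply: eq_bigr => v _.
rewrite (bigD1 (sigma v)) //= eqxx big1 ?addn0 // => k.
by rewrite eq_sym => /negPf ->.
Qed.

(** Each side carries the unit that the other loses, which avoids truncated subtraction and covers
    the case [i = sigma v] as well. *)
Lemma colour_count_recolour (N q : nat) (sigma : config N q) (v : 'I_N)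
    (i k : 'I_q) :
  (colour_count (recolour sigma v i) k + (k == sigma v) =
   colour_count sigma k + (k == i))%N.
Proof.
rewrite !colour_countE (bigD1 v) //= [in RHS](bigD1 v) //= ffunE eqxx.
under eq_bigr => u /negPf uv do rewrite ffunE uv.
by rewrite (eq_sym i) (eq_sym (sigma v)) addnC addnA [RHS]addnAC.
Qed.

Lemma recolour_id (N q : nat) (sigma : config N q) (v : 'I_N) :
  recolour sigma v (sigma v) = sigma.
Proof. by apply/ffunP => u; rewrite ffunE; case: eqP => [->|]. Qed.

Lemma deviation_recolour (R : realType) (N q : nat) (x : 'rV[R]_q)
    (sigma : config N q) (v : 'I_N) (i k : 'I_q) :
  deviation x (recolour sigma v i) k =
  deviation x sigma k + ((k == i)%:R - (k == sigma v)%:R) / N%:R.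
Proof.
have /(congr1 (fun n => n%:R : R)) := colour_count_recolour N q sigma v i k.
rewrite !natrD /deviation => /eqP; rewrite -subr_eq => /eqP <-; lra.
Qed.

(** Two coordinates move, by 1/N and -1/N: the cross terms give the difference of deviations and the
    two squares give 2/N. For [i = sigma v] nothing moves and the 2/N would be wrong. *)
Lemma sq_deviation_recolour (R : realType) (N q : nat) (x : 'rV[R]_q)
    (sigma : config N q) (v : 'I_N) (i : 'I_q) : i != sigma v ->
  N%:R * sq_deviation x (recolour sigma v i) =
  N%:R * sq_deviation x sigma +
  2 * (deviation x sigma i - deviation x sigma (sigma v)) + 2 / N%:R.
Proof.
move=> iv; have N0 : (N%:R : R) != 0 by rewrite pnatr_eq0; case: N v {sigma iv} => [[]|].
rewrite /sq_deviation; set d := deviation x sigma.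
have -> : \sum_k deviation x (recolour sigma v i) k ^+ 2 =
  \sum_k d k ^+ 2 + 2 / N%:R * (\sum_k d k * (k == i)%:R
    - \sum_k d k * (k == sigma v)%:R)
  + N%:R ^- 2 * (\sum_k 1 * (k == i)%:R + \sum_k 1 * (k == sigma v)%:R).
  rewrite -sumrB -big_split /= !mulr_sumr -!big_split /=.
  apply: eq_bigr => k _; rewrite deviation_recolour -/d.
  case: (eqVneq k i) => [->|ki]; last by case: eqP => _ /=; field.
  by rewrite (negPf iv) /=; field.
by rewrite !sum_delta; field.
Qed.

Lemma sum_deviation (R : realType) (N q : nat) (x : 'rV[R]_q)
    (sigma : config N q) : (0 < N)%N -> \sum_k x 0 k = 1 ->
  \sum_k deviation x sigma k = 0.
Proof.
move=> N0 x1; rewrite sumrB x1 -mulr_suml -natr_sum sum_colour_count_nat.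
by rewrite divff ?subrr // pnatr_eq0 -lt0n.
Qed.

Lemma near_configsE (R : realType) (N q : nat) (x : 'rV[R]_q) (r : R)
    (sigma : config N q) : 0 <= r ->
  (sigma \in near_configs N x r) = (sq_deviation x sigma <= r ^+ 2).
Proof.
move=> r0; rewrite inE /norm2 -{1}(ger0_norm r0) -sqrtr_sqr ler_sqrt ?sqr_ge0 //.
by congr (_ <= _); apply: eq_bigr => k _; rewrite !mxE.
Qed.

                                           

(** * Averaging over vertex permutations, and paths inside the ball *)

Definition shuffle (N q : nat) (sigma : config N q) (p : {perm 'I_N}) :
    config N q :=
  [ffun u => sigma (p u)].

Definition symmetrise (R : realType) (N q : nat) (H : config N q -> R)
    (sigma : config N q) : R :=
  (\sum_(p : {perm 'I_N}) H (shuffle N q sigma p)) / #|{perm 'I_N}|%:R.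

Arguments shuffle {N q} sigma p.
Arguments symmetrise {R N q} H sigma.

Lemma colour_count_shuffle (N q : nat) (sigma : config N q) (p : {perm 'I_N})
    (k : 'I_q) :
  colour_count (shuffle sigma p) k = colour_count sigma k.
Proof.
rewrite !colour_countE [RHS](reindex_inj (@perm_inj _ p)).
by apply: eq_bigr => v _; rewrite ffunE.
Qed.

(** Equal counts make the two colourings, read as tuples, permutations of each other. *)
Lemma eq_colour_count_shuffle (N q : nat) (sigma tau : config N q) :
  colour_count sigma =1 colour_count tau ->
  exists p, tau = shuffle sigma p.
Proof.
move=> st.
have : perm_eq [tuple tau u | u < N] [tuple sigma u | u < N].
  have E (f : config N q) (k : 'I_q) :
      count_mem k [tuple f u | u < N] = colour_count f k.
    rewrite /colour_count cardE size_filter -enumT /= count_map.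
    by apply: eq_count => u.
  by apply/allP => k _; rewrite /= !E st.
move=> /tuple_permP[p /val_inj pE]; exists p; apply/ffunP => u.
by rewrite ffunE; have := congr1 (fun t => tnth t u) pE; rewrite !tnth_mktuple.
Qed.

Lemma shuffleM (N q : nat) (sigma : config N q) (p p' : {perm 'I_N}) :
  shuffle (shuffle sigma p) p' = shuffle sigma (p' * p)%g.
Proof. by apply/ffunP => u; rewrite !ffunE permM. Qed.

Lemma shuffle_inj (N q : nat) (p : {perm 'I_N}) :
  injective (fun sigma : config N q => shuffle sigma p).
Proof.
move=> sigma tau /(congr1 (fun f => shuffle f p^-1%g)).
rewrite !shuffleM mulVg => e; apply/ffunP => u.
by have := congr1 (fun f : config N q => f u) e; rewrite !ffunE perm1.
Qed.

Lemma shuffle_recolour (N q : nat) (sigma : config N q) (p : {perm 'I_N})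
    (v : 'I_N) (i : 'I_q) :
  shuffle (recolour sigma v i) p = recolour (shuffle sigma p) ((p^-1)%g v) i.
Proof.
by apply/ffunP => u; rewrite !ffunE (canF_eq (permK p)).
Qed.

Lemma card_perm_gt0 (N : nat) : (0 < #|{perm 'I_N}|)%N.
Proof. by apply/card_gt0P; exists 1%g. Qed.

Lemma symmetrise_eq (R : realType) (N q : nat) (H : config N q -> R)
    (sigma tau : config N q) :
  colour_count sigma =1 colour_count tau ->
  symmetrise H sigma = symmetrise H tau.
Proof.
move=> /eq_colour_count_shuffle[p ->]; rewrite /symmetrise; congr (_ / _).
under [RHS]eq_bigr => s _ do rewrite shuffleM.
by rewrite (reindex_inj (mulIg p)).
Qed.

(** Exchange the two sums: each permutation merely reindexes the sum over [A], so all the inner sums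
    coincide. *)
Lemma sum_symmetrise (R : realType) (N q : nat) (A : {set config N q})
    (W H : config N q -> R) :
  (forall sigma p, (shuffle sigma p \in A) = (sigma \in A)) ->
  (forall sigma p, W (shuffle sigma p) = W sigma) ->
  \sum_(sigma in A) W sigma * symmetrise H sigma =
  \sum_(sigma in A) W sigma * H sigma.
Proof.
move=> AE WE; rewrite /symmetrise.
under eq_bigr => s _ do rewrite mulrA mulr_sumr.
rewrite -mulr_suml exchange_big /=.
rewrite (eq_bigr (fun=> \sum_(s in A) W s * H s)); last first.
  move=> p _; rewrite [RHS](reindex_inj (@shuffle_inj N q p)) /=.
  by apply: eq_big => s; rewrite ?AE ?WE.
rewrite sumr_const -[X in X / _]mulr_natr mulfK // pnatr_eq0 -lt0n.
exact: card_perm_gt0.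
Qed.

Lemma symmetrise_recolour (R : realType) (N q : nat) (A : {set config N q})
    (H : config N q -> R) (L : R) (sigma : config N q) (v : 'I_N) (i : 'I_q) :
  (forall sigma p, (shuffle sigma p \in A) = (sigma \in A)) ->
  (forall sigma v i, sigma \in A -> recolour sigma v i \in A ->
    `|H sigma - H (recolour sigma v i)| <= L) ->
  sigma \in A -> recolour sigma v i \in A ->
  `|symmetrise H sigma - symmetrise H (recolour sigma v i)| <= L.
Proof.
move=> AE HL sA rA; rewrite /symmetrise -mulrBl -sumrB.
have c0 : 0 < (#|{perm 'I_N}|%:R : R) by rewrite ltr0n card_perm_gt0.
rewrite normrM [`|_^-1|]ger0_norm ?invr_ge0 ?(ltW c0) //.
rewrite ler_pdivrMr //; apply: (le_trans (ler_norm_sum _ _ _)).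
rewrite mulr_natr -sumr_const; apply: ler_sum => p _.
by rewrite shuffle_recolour HL ?AE // -shuffle_recolour AE.
Qed.

Lemma near_configs_shuffle (R : realType) (N q : nat) (x : 'rV[R]_q) (r : R)
    (sigma : config N q) (p : {perm 'I_N}) :
  (shuffle sigma p \in near_configs N x r) = (sigma \in near_configs N x r).
Proof.
rewrite !inE; congr (norm2 (_ - _) <= _); apply/rowP => k; rewrite !mxE.
by congr (_%:R / _); exact: colour_count_shuffle.
Qed.

Lemma sq_deviation_shuffle (R : realType) (N q : nat) (x : 'rV[R]_q)
    (sigma : config N q) (p : {perm 'I_N}) :
  sq_deviation x (shuffle sigma p) = sq_deviation x sigma.
Proof.
by apply: eq_bigr => k _; rewrite /deviation colour_count_shuffle.
Qed.

(** By [sq_deviation_recolour] the squared deviation does not grow when the old colour exceeds the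
    new one, in deviation, by at least 1/N. *)
Lemma near_configs_recolour (R : realType) (N q : nat) (x : 'rV[R]_q) (r : R)
    (sigma : config N q) (v : 'I_N) (i : 'I_q) : 0 <= r ->
  sigma \in near_configs N x r -> i != sigma v ->
  N%:R^-1 <= deviation x sigma (sigma v) - deviation x sigma i ->
  recolour sigma v i \in near_configs N x r.
Proof.
move=> r0; rewrite !near_configsE // => sA iv dle.
have N0 : 0 < (N%:R : R) by rewrite ltr0n; case: N v {sigma iv sA dle} => [[]|].
apply: le_trans sA; rewrite -(ler_pM2l N0) sq_deviation_recolour //; lra.
Qed.

                                                                            
                                                                              
                                                                          
                                                                           
(** Truncated subtraction gives the positive parts, so the sum is the number of vertices to
    recolour. Induction on it: one legal move, made at whichever end of the path stays in the ball,
    lowers it by one. *)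
Lemma symmetrise_near_lipschitz (R : realType) (N q : nat) (x : 'rV[R]_q) (r : R)
    (H : config N q -> R) (L : R) (sigma tau : config N q) : 0 <= r ->
  (forall sigma v i, sigma \in near_configs N x r ->
    recolour sigma v i \in near_configs N x r ->
    `|H sigma - H (recolour sigma v i)| <= L) ->
  sigma \in near_configs N x r -> tau \in near_configs N x r ->
  `|symmetrise H sigma - symmetrise H tau| <=
  L * (\sum_k (colour_count tau k - colour_count sigma k))%:R.
Proof.
move=> r0 HL; set m := (\sum_k _)%N; move mE : m => n; rewrite /m in mE.
elim: n => [|n IH] in sigma tau {m} mE * => sA tA.
  have le k : (colour_count tau k <= colour_count sigma k)%N.
    move/eqP: mE; rewrite sum_nat_eq0 => /forallP/(_ k) /=.
    by rewrite subn_eq0.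
  (* No excess anywhere: the counts are ordered and both sum to N, so they agree. *)
  rewrite (symmetrise_eq _ _ _ H sigma tau) ?subrr ?normr0 ?mulr0 // => k.
  apply/esym/eqP; have [_ ] := leqif_sum (fun k (_ : true) => leqif_eq (le k)).
  by rewrite !sum_colour_count_nat eqxx => /esym/forallP/(_ k).
have [i iP] : exists i, (colour_count sigma i < colour_count tau i)%N.
  apply/existsP; apply: contra_eqT mE => /existsPn le.
  by rewrite big1 // => k _; apply/eqP; rewrite subn_eq0 leqNgt.
have [j jP] : exists j, (colour_count tau j < colour_count sigma j)%N.
  apply/existsP; apply: contraTT (iP) => /existsPn le; rewrite -leqNgt.
  have le' k : (colour_count sigma k <= colour_count tau k)%N by rewrite leqNgt.
  have [_ ] := leqif_sum (fun k (_ : true) => leqif_eq (le' k)).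
  by rewrite !sum_colour_count_nat eqxx => /esym/forallP/(_ i) /= /eqP ->.
have ij : i != j by apply: contraTneq iP => ->; rewrite -leqNgt ltnW.
have [v /eqP vj] : exists v, sigma v == j.
  by have /card_gt0P[u uP] := leq_ltn_trans (leq0n _) jP; exists u.
have [w /eqP wi] : exists w, tau w == i.
  by have /card_gt0P[u uP] := leq_ltn_trans (leq0n _) iP; exists u.
have N0 : 0 < (N%:R : R) by rewrite ltr0n (leq_ltn_trans _ (ltn_ord v)).
(* Serves both moves: gaining a vertex of colour [i] at [sigma], or losing one at [tau], removes one
   unit of excess at [i] and none elsewhere. *)
have step s t : (forall k, colour_count t k - colour_count s k + (k == i) =
    colour_count tau k - colour_count sigma k)%N ->
    (\sum_k (colour_count t k - colour_count s k))%N = n.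
  move=> E; have : (\sum_k (colour_count t k - colour_count s k + (k == i)) =
      n.+1)%N by rewrite -mE; apply: eq_bigr => k _; exact: E.
  have -> : (\sum_k (colour_count t k - colour_count s k + (k == i)) =
      \sum_k (colour_count t k - colour_count s k) + 1)%N.
    rewrite big_split /=; congr (_ + _)%N; rewrite (bigD1 i) //= eqxx big1 //.
    by move=> k /negPf ->.
  by rewrite addn1 => -[].
have Lsplit : L * n.+1%:R = L + L * n%:R by rewrite -natr1 mulrDr mulr1 addrC.
rewrite Lsplit.
(* If the deviation of [j] is well above that of [i] at [sigma], the move from [j] to [i] is made
   there. *)
have [le|lt] := leP N%:R^-1 (deviation x sigma j - deviation x sigma i).
  have sA' : recolour sigma v i \in near_configs N x r.
    by apply: near_configs_recolour; rewrite // vj.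
  apply: le_trans (ler_distD (symmetrise H (recolour sigma v i)) _ _) _.
  apply: lerD; last apply: IH => //.
    exact: symmetrise_recolour (near_configs_shuffle R N q x r) HL sA sA'.
  apply: step => k; have := colour_count_recolour N q sigma v i k; rewrite vj.
  case: (eqVneq k i) => [->|ki]; first by rewrite (negPf ij); lia.
  by case: (eqVneq k j) => [->|kj]; lia.
(* Otherwise the opposite move is legal at [tau]: there [i] has at least one more vertex and [j] at
   least one fewer than in [sigma], so the deviation of [i] exceeds that of [j] by more than -1/N +
   2/N. *)
have tA' : recolour tau w j \in near_configs N x r.
  apply: near_configs_recolour; rewrite // wi 1?eq_sym //.
  move: lt; rewrite /deviation => lt.
  have iP' : (colour_count sigma i)%:R + 1 <= (colour_count tau i)%:R :> R.
    by rewrite natr1 ler_nat.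
  have jP' : (colour_count tau j)%:R + 1 <= (colour_count sigma j)%:R :> R.
    by rewrite natr1 ler_nat.
  have iP2 : ((colour_count sigma i)%:R + 1) / N%:R <= (colour_count tau i)%:R / N%:R :> R.
    by rewrite ler_pM2r ?invr_gt0.
  have jP2 : ((colour_count tau j)%:R + 1) / N%:R <= (colour_count sigma j)%:R / N%:R :> R.
    by rewrite ler_pM2r ?invr_gt0.
  by rewrite !mulrDl mul1r in iP2 jP2; lra.
apply: le_trans (ler_distD (symmetrise H (recolour tau w j)) _ _) _.
rewrite addrC (distrC _ (symmetrise H tau)); apply: lerD; last apply: IH => //.
  exact: symmetrise_recolour (near_configs_shuffle R N q x r) HL tA tA'.
apply: step => k; have := colour_count_recolour N q tau w j k; rewrite wi.
case: (eqVneq k i) => [->|ki]; first by rewrite (negPf ij); lia.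
by case: (eqVneq k j) => [->|kj]; lia.
Qed.

                                        

(** * Drift of the squared deviation and its mean under a tilted weight *)

(** From exp(-y) >= 1 - y one gets exp(y) <= 1/(1 - y), which is below the quadratic for y in
    [0, 1/2]. *)
Lemma expR_le_quadratic (R : realType) (y : R) :
  0 <= y -> y <= 1 / 2 -> expR y <= 1 + y + 2 * y ^+ 2.
Proof.
move=> y0 y2; have := expR_ge1Dx (- y); rewrite expRN => le.
have e0 := expR_gt0 y; have : expR y * (1 - y) <= 1.
  by rewrite -ler_pdivlMl // mulr1.
have y20 : 0 <= y ^+ 2 * (1 - 2 * y) by apply: mulr_ge0; [exact: sqr_ge0|lra].
move=> le1; have y1 : 0 < 1 - y by lra.
rewrite -(ler_pM2r y1); apply: (le_trans le1).
have -> : (1 + y + 2 * y ^+ 2) * (1 - y) = 1 + y ^+ 2 * (1 - 2 * y) by ring.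
by rewrite lerDl.
Qed.

(** For y >= 0 this is [expR_le_quadratic] times y; for y < 0 the tangent bound exp(by) >= 1 + by is
    reversed by the factor y. *)
Lemma mul_expR_le (R : realType) (b y : R) : 0 <= b -> b * `|y| <= 1 / 2 ->
  y * expR (b * y) <= y + b * y ^+ 2 + 2 * b ^+ 2 * `|y| * y ^+ 2.
Proof.
move=> b0; case: (ger0P y) => y0 by2.
  have := expR_le_quadratic R (b * y) (mulr_ge0 b0 y0) by2.
  move=> /(ler_wpM2l y0)/le_trans; apply; rewrite le_eqVlt; apply/orP; left.
  by apply/eqP; ring.
have := expR_ge1Dx (b * y) => /(ler_wnM2l (ltW y0))/le_trans; apply.
rewrite -subr_ge0.
have -> : y + b * y ^+ 2 + 2 * b ^+ 2 * - y * y ^+ 2 - y * (1 + b * y) =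
  2 * b ^+ 2 * (- y) * y ^+ 2 by ring.
have ny0 : 0 <= - y by lra.
by rewrite mulr_ge0 ?sqr_ge0 // mulr_ge0 // mulr_ge0 ?sqr_ge0.
Qed.

                                                                              
                                                                               
                                                
(** Here [S j] weighs the old colour and [x i] the proposed one. Expand in b: the linear term is
    exactly -|d|^2 since S = x + d, the quadratic term is 2b times the variance of d under x, hence
    at most (1 - c) |d|^2, and what remains is cubic in d, so at most r times a multiple of |d|^2,
    absorbed by half of c. *)
Lemma drift_le (R : realType) (q : nat) (S x d : 'I_q -> R) (b c r : R) :
  (forall k, d k = S k - x k) ->
  (forall k, 0 <= S k) -> \sum_k S k = 1 ->
  (forall k, 0 <= x k) -> \sum_k x k = 1 ->
  (forall k, `|d k| <= r) -> 0 <= b -> 2 * b * r <= 1 / 2 ->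
  2 * b * (\sum_k x k * d k ^+ 2 - (\sum_k x k * d k) ^+ 2) <=
    (1 - c) * \sum_k d k ^+ 2 ->
  r * (2 * b * (q%:R + 1) + 16 * b ^+ 2) <= c / 2 ->
  \sum_j \sum_i S j * x i * ((d i - d j) * expR (b * (d i - d j))) <=
  - (c / 2) * \sum_k d k ^+ 2.
Proof.
move=> dE S0 S1 x0 x1 dr b0 br var rc.
set Q := \sum_k d k ^+ 2 in var *.
have Q0 : 0 <= Q by apply: sumr_ge0 => k _; exact: sqr_ge0.
have dd i j : `|d i - d j| <= 2 * r.
  by rewrite (le_trans (ler_normB _ _)) // mulr2n mulrDl mul1r lerD.
have r0 : 0 <= r.
  case: (pickP (predT : pred 'I_q)) => [i _|none].
    exact: le_trans (normr_ge0 _) (dr i).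
  by move/eqP: S1; rewrite big_pred0 // eq_sym oner_eq0.
have S_le1 j : S j <= 1 by rewrite -S1 (bigD1 j) //= lerDl sumr_ge0.
have x_le1 j : x j <= 1 by rewrite -x1 (bigD1 j) //= lerDl sumr_ge0.
have wQ (w : 'I_q -> R) : (forall k, w k <= 1) -> \sum_k w k * d k ^+ 2 <= Q.
  by move=> w1; apply: ler_sum => k _; rewrite ler_piMl ?sqr_ge0.
(* The third line is the error of replacing [S j] by [x j] in the quadratic term, with |d j| <= r;
   the fourth is the cubic remainder, with |d i - d j| <= 2r. Both use (d i - d j)^2 <= 2 (d i^2 + d
   j^2). *)
pose T := \sum_j \sum_i S j * x i * (d i - d j)
  + b * (\sum_j \sum_i x j * x i * (d i - d j) ^+ 2)
  + b * r * (\sum_(j < q) \sum_i x i * (2 * (d i ^+ 2 + d j ^+ 2)))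
  + 4 * b ^+ 2 * r * (\sum_j \sum_i S j * x i * (2 * (d i ^+ 2 + d j ^+ 2))).
have le1 : \sum_j \sum_i S j * x i * ((d i - d j) * expR (b * (d i - d j))) <= T.
  rewrite /T !mulr_sumr -!big_split /=; apply: ler_sum => j _.
  rewrite !mulr_sumr -!big_split /=; apply: ler_sum => i _.
  set y := d i - d j.
  have y_le : b * `|y| <= 1 / 2.
    by rewrite (le_trans _ br) // -mulrA mulrCA ler_wpM2l // dd.
  have yy : y ^+ 2 <= 2 * (d i ^+ 2 + d j ^+ 2).
    rewrite -subr_ge0; have -> : 2 * (d i ^+ 2 + d j ^+ 2) - y ^+ 2 =
      (d i + d j) ^+ 2 by rewrite /y; ring.
    exact: sqr_ge0.
  set z := 2 * (d i ^+ 2 + d j ^+ 2) in yy *; have z0 : 0 <= z by rewrite (le_trans (sqr_ge0 y)).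
  have Sx0 : 0 <= S j * x i by rewrite mulr_ge0.
  apply: le_trans (ler_wpM2l Sx0 (mul_expR_le R b y b0 y_le)) _.
  have -> : S j * x i * (y + b * y ^+ 2 + 2 * b ^+ 2 * `|y| * y ^+ 2) =
    S j * x i * y + b * (x j * x i * y ^+ 2) + b * (d j * (x i * y ^+ 2))
    + 2 * b ^+ 2 * (S j * x i * (`|y| * y ^+ 2)) by rewrite (dE j); move: (`|y|) => ay; ring.
  rewrite lerD ?lerD //.
    rewrite -[leRHS]mulrA ler_wpM2l // (le_trans (ler_norm _)) // normrM.
    rewrite ler_pM ?normr_ge0 // ger0_norm ?(mulr_ge0 (x0 i) (sqr_ge0 y)) //.
    by rewrite ler_wpM2l.
  rewrite [leRHS](_ : _ = 2 * b ^+ 2 * (S j * x i * ((2 * r) * z))); last by ring.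
  have b20 : 0 <= 2 * b ^+ 2 by rewrite mulr_ge0 ?sqr_ge0.
  by rewrite ler_wpM2l // ler_wpM2l // ler_pM ?sqr_ge0 ?normr_ge0 ?dd.
have E1 : \sum_j \sum_i S j * x i * (d i - d j) = - Q.
  have -> : \sum_j \sum_i S j * x i * (d i - d j) =
    (\sum_j S j) * (\sum_i x i * d i) - (\sum_j S j * d j) * \sum_i x i.
    rewrite !mulr_suml -sumrB; apply: eq_bigr => j _.
    by rewrite !mulr_sumr -sumrB; apply: eq_bigr => i _; ring.
  rewrite S1 x1 mul1r mulr1 -sumrB -sumrN; apply: eq_bigr => k _.
  by rewrite dE; ring.
have E2 : \sum_j \sum_i x j * x i * (d i - d j) ^+ 2 =
    2 * (\sum_k x k * d k ^+ 2 - (\sum_k x k * d k) ^+ 2).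
  have -> : \sum_j \sum_i x j * x i * (d i - d j) ^+ 2 =
    (\sum_j x j) * (\sum_i x i * d i ^+ 2) + (\sum_j x j * d j ^+ 2) * (\sum_i x i)
    - (\sum_j x j * d j) * (\sum_i x i * (2 * d i)).
    rewrite !mulr_suml -big_split -sumrB /=; apply: eq_bigr => j _.
    by rewrite !mulr_sumr -big_split -sumrB /=; apply: eq_bigr => i _; ring.
  rewrite x1 mul1r mulr1; under [in X in _ - _ * X]eq_bigr => i _ do rewrite mulrCA.
  by rewrite -mulr_sumr; ring.
have E3 : \sum_(j < q) \sum_i x i * (2 * (d i ^+ 2 + d j ^+ 2)) <= 2 * (q%:R + 1) * Q.
  have -> : \sum_(j < q) \sum_i x i * (2 * (d i ^+ 2 + d j ^+ 2)) =
    2 * (q%:R * (\sum_i x i * d i ^+ 2) + (\sum_j d j ^+ 2) * \sum_i x i).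
    have -> : (q%:R : R) * (\sum_i x i * d i ^+ 2) =
        \sum_(j < q) \sum_i x i * d i ^+ 2.
      by rewrite sumr_const card_ord mulr_natl.
    rewrite mulr_suml -big_split mulr_sumr /=; apply: eq_bigr => j _.
    by rewrite mulr_sumr -big_split mulr_sumr /=; apply: eq_bigr => i _; ring.
  rewrite x1 mulr1 -/Q -mulrA ler_wpM2l // mulrDl mul1r lerD2r ler_wpM2l //.
  exact: wQ.
have E4 : \sum_j \sum_i S j * x i * (2 * (d i ^+ 2 + d j ^+ 2)) <= 4 * Q.
  have -> : \sum_j \sum_i S j * x i * (2 * (d i ^+ 2 + d j ^+ 2)) =
    2 * ((\sum_j S j) * (\sum_i x i * d i ^+ 2) + (\sum_j S j * d j ^+ 2) * \sum_i x i).
    rewrite !mulr_suml -big_split mulr_sumr /=; apply: eq_bigr => j _.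
    by rewrite !mulr_sumr -big_split mulr_sumr /=; apply: eq_bigr => i _; ring.
  have := wQ x x_le1; have := wQ S S_le1.
  by rewrite S1 x1 mul1r mulr1; lra.
apply: (le_trans le1); rewrite /T E1 E2.
have br0 : 0 <= b * r by rewrite mulr_ge0 // r0.
have := ler_wpM2l br0 E3.
have b2r0 : 0 <= 4 * b ^+ 2 * r by rewrite !mulr_ge0 ?sqr_ge0 // r0.
have := ler_wpM2l b2r0 E4.
have := ler_wpM2r Q0 rc.
lra.
Qed.

(** Tilt [b = 0] is the product measure; at a macrostate [b = beta] is the Potts measure up to a
    constant. *)
Definition tilted_weight (R : realType) (N q : nat) (x : 'rV[R]_q) (b : R)
    (sigma : config N q) : R :=
  product_measure x sigma * expR (b * (N%:R * sq_deviation x sigma)).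

Arguments tilted_weight {R N q} x b sigma.

(** The map from (sigma, i) to ([recolour sigma v i], [sigma v]) is an involution that exchanges the
    two ends of a move, so the sum equals its opposite. *)
Lemma sum_recolour_antisym (R : realType) (N q : nat) (v : 'I_N)
    (F : config N q -> config N q -> R) :
  (forall sigma i, F (recolour sigma v i) sigma = - F sigma (recolour sigma v i)) ->
  \sum_sigma \sum_i F sigma (recolour sigma v i) = 0.
Proof.
move=> anti; pose g (p : config N q * 'I_q) := (recolour p.1 v p.2, p.1 v).
have gK : involutive g.
  case=> sigma i; rewrite /g /= ffunE eqxx; congr (_, _).
  by apply/ffunP => u; rewrite !ffunE; case: eqP => [->|].
set S := LHS; have SE : S = \sum_p F p.1 (recolour p.1 v p.2).
  by rewrite /S pair_bigA.
have : S = - S.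
  rewrite {2}SE -sumrN SE (reindex_inj (inv_inj gK)) /=; apply: eq_bigr => p _.
  have := gK p; rewrite {1}/g /= => /(congr1 fst) /= ->.
  exact: anti.
lra.
Qed.

Lemma product_measure_recolour (R : realType) (N q : nat) (x : 'rV[R]_q)
    (sigma : config N q) (v : 'I_N) (i : 'I_q) :
  product_measure x (recolour sigma v i) * x 0 (sigma v) =
  product_measure x sigma * x 0 i.
Proof.
rewrite /product_measure (bigD1 v) //= [in RHS](bigD1 v) //= ffunE eqxx.
under eq_bigr => u /negPf uv do rewrite ffunE uv.
by ring.
Qed.

Lemma product_measure_ge0 (R : realType) (N q : nat) (x : 'rV[R]_q)
    (sigma : config N q) : (forall k, 0 <= x 0 k) -> 0 <= product_measure x sigma.
Proof. by move=> x0; apply: prodr_ge0. Qed.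

                                                                                
                                                                                
                                                            
(** The rates x_i exp(b (phi(tau) - phi(sigma))/2) satisfy detailed balance for the tilted weight,
    so moves with both ends in the ball contribute zero in total. The ball is a sublevel set of phi,
    hence every move that leaves it has a nonnegative increment. *)
Lemma mean_drift_ge0 (R : realType) (N q : nat) (x : 'rV[R]_q) (b r : R) :
  (forall k, 0 <= x 0 k) -> 0 <= r ->
  0 <= \sum_(sigma in near_configs N x r) tilted_weight x b sigma *
    \sum_v \sum_i x 0 i *
      (expR (b * (N%:R * sq_deviation x (recolour sigma v i) -
                  N%:R * sq_deviation x sigma) / 2) *
       (N%:R * sq_deviation x (recolour sigma v i) -
        N%:R * sq_deviation x sigma)).
Proof.
move=> x0 r0; pose A := near_configs N x r.
pose phi (sigma : config N q) := N%:R * sq_deviation x sigma.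
(* The flow of phi along a move, put to 0 as soon as one end lies outside the ball, which keeps it
   antisymmetric. *)
pose F v (sigma tau : config N q) := if (sigma \in A) && (tau \in A) then
  tilted_weight x b sigma * (x 0 (tau v) *
    (expR (b * (phi tau - phi sigma) / 2) * (phi tau - phi sigma))) else 0.
have F0 : \sum_v \sum_sigma \sum_i F v sigma (recolour sigma v i) = 0.
  rewrite big1 // => v _; apply: sum_recolour_antisym => sigma i.
  rewrite /F andbC; case: ifP => _; last by rewrite oppr0.
  rewrite ffunE eqxx /tilted_weight -/(phi (recolour sigma v i)) -/(phi sigma).
  have e (s t : R) : expR (b * s) * expR (b * (t - s) / 2) =
    expR (b * (s + t) / 2) by rewrite -expRD; congr expR; lra.
  transitivity (product_measure x (recolour sigma v i) * x 0 (sigma v) *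
    (expR (b * phi (recolour sigma v i)) *
     expR (b * (phi sigma - phi (recolour sigma v i)) / 2)) *
    (phi sigma - phi (recolour sigma v i))); first by ring.
  transitivity (- (product_measure x sigma * x 0 i *
    (expR (b * phi sigma) *
     expR (b * (phi (recolour sigma v i) - phi sigma) / 2)) *
    (phi (recolour sigma v i) - phi sigma))); last by ring.
  rewrite !e product_measure_recolour (addrC (phi sigma) (phi _)); ring.
rewrite -[leLHS]F0 exchange_big [leRHS]big_mkcond /=; apply: ler_sum => sigma _.
have [sA|sA] := boolP (sigma \in A); last first.
  by rewrite big1 // => v _; rewrite big1 // => i _; rewrite /F (negPf sA).
rewrite mulr_sumr; apply: ler_sum => v _; rewrite mulr_sumr.
apply: ler_sum => i _; rewrite /F sA /= ffunE eqxx -/(phi (recolour sigma v i)) -/(phi sigma).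
case: ifP => // /negbT out; have W0 : 0 <= tilted_weight x b sigma.
  by rewrite /tilted_weight mulr_ge0 ?expR_ge0 ?product_measure_ge0.
rewrite mulr_ge0 // mulr_ge0 // mulr_ge0 ?expR_ge0 // subr_ge0.
rewrite /phi ler_wpM2l ?ler0n //; move: sA out.
rewrite !near_configsE // -ltNge => sA /ltW; exact: le_trans.
Qed.

(** The mean drift is nonnegative by [mean_drift_ge0], yet pointwise it is at most a positive
    constant times exp(2br) - (c/2) phi; averaging bounds the mean of phi independently of N. *)
Lemma sq_deviation_moment (R : realType) (N q : nat) (x : 'rV[R]_q)
    (b c r : R) :
  (0 < N)%N -> (forall k, 0 <= x 0 k) -> \sum_k x 0 k = 1 ->
  0 <= b -> 0 < c -> 0 <= r -> 2 * b * r <= 1 / 2 ->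
  (forall d : 'I_q -> R, \sum_k d k = 0 ->
    2 * b * (\sum_k x 0 k * d k ^+ 2 - (\sum_k x 0 k * d k) ^+ 2) <=
    (1 - c) * \sum_k d k ^+ 2) ->
  r * (2 * b * (q%:R + 1) + 16 * b ^+ 2) <= c / 2 ->
  \sum_(sigma in near_configs N x r)
    tilted_weight x b sigma * (N%:R * sq_deviation x sigma) <=
  2 * expR (2 * b * r) / c *
    \sum_(sigma in near_configs N x r) tilted_weight x b sigma.
Proof.
move=> N0 x0 x1 b0 c0 r0 br var rc.
have NR0 : 0 < (N%:R : R) by rewrite ltr0n.
have := mean_drift_ge0 R N q x b r x0 r0.
have W0 (sigma : config N q) : 0 <= tilted_weight x b sigma.
  by rewrite /tilted_weight mulr_ge0 ?expR_ge0 ?product_measure_ge0.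
pose D (sigma : config N q) := \sum_v \sum_i x 0 i *
  (expR (b * (N%:R * sq_deviation x (recolour sigma v i) -
              N%:R * sq_deviation x sigma) / 2) *
   (N%:R * sq_deviation x (recolour sigma v i) - N%:R * sq_deviation x sigma)).
rewrite -[leRHS]/(\sum_(sigma in _) tilted_weight x b sigma * D sigma) => D0.
have DE (sigma : config N q) : sigma \in near_configs N x r ->
    D sigma <= 2 * expR (b / N%:R) *
      (expR (2 * b * r) - c / 2 * (N%:R * sq_deviation x sigma)).
  move=> sA; set d := deviation x sigma.
  pose S k : R := (colour_count sigma k)%:R / N%:R.
  have dr k : `|d k| <= r.
    rewrite -(ger0_norm r0) -ler_sqr ?nnegrE ?normr_ge0 // !real_normK ?num_real //.
    move: sA; rewrite near_configsE //; apply: le_trans.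
    by rewrite /sq_deviation (bigD1 k) //= lerDl sumr_ge0 // => j _; rewrite sqr_ge0.
  have dd i j : d i - d j <= 2 * r.
    rewrite (le_trans (ler_norm _)) // (le_trans (ler_normB _ _)) //.
    by rewrite mulr2n mulrDl mul1r lerD.
  have S0 k : 0 <= S k by rewrite divr_ge0.
  have S1 : \sum_k S k = 1.
    by rewrite -mulr_suml -natr_sum sum_colour_count_nat divff ?gt_eqF.
  pose g j i := x 0 i * (2 * expR (b / N%:R) *
    (expR (b * (d i - d j)) * (d i - d j + N%:R^-1))).
  (* Equality for a genuine move, whose increment of phi is 2 (d i - d j + 1/N); for [i = sigma v]
     the true term is 0 while [g] is nonnegative. *)
  have step : D sigma <= \sum_v \sum_i g (sigma v) i.
    apply: ler_sum => v _; apply: ler_sum => i _; rewrite /g ler_wpM2l //.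
    have [->|iv] := eqVneq i (sigma v).
      rewrite recolour_id !subrr !mulr0 expR0 mul1r add0r.
      by rewrite mulr_ge0 ?invr_ge0 // mulr_ge0 ?expR_ge0.
    rewrite sq_deviation_recolour // -/d.
    have -> : N%:R * sq_deviation x sigma + 2 * (d i - d (sigma v)) + 2 / N%:R
      - N%:R * sq_deviation x sigma = 2 * (d i - d (sigma v) + N%:R^-1) by ring.
    have -> : b * (2 * (d i - d (sigma v) + N%:R^-1)) / 2 =
      b / N%:R + b * (d i - d (sigma v)) by field; rewrite gt_eqF.
    by rewrite expRD le_eqVlt; apply/orP; left; apply/eqP; ring.
  rewrite (le_trans step) // (sum_colour_count R N q sigma (fun j => \sum_i g j i)).
  (* Counts are N times proportions, so the drift of [drift_le] gets a factor N while the 1/N of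
     each increment leaves a term of order one, bounded below by exp(2br). *)
  have -> : \sum_k (colour_count sigma k)%:R * \sum_i g k i =
    2 * expR (b / N%:R) * (N%:R *
     (\sum_j \sum_i S j * x 0 i * ((d i - d j) * expR (b * (d i - d j)))) +
     \sum_j \sum_i S j * x 0 i * expR (b * (d i - d j))).
    rewrite mulr_sumr -big_split mulr_sumr /=; apply: eq_bigr => j _.
    rewrite !mulr_sumr -big_split mulr_sumr /=; apply: eq_bigr => i _.
    by rewrite /g /S; field; rewrite gt_eqF.
  have e0 : 0 <= 2 * expR (b / N%:R) by rewrite mulr_ge0 ?expR_ge0.
  rewrite ler_wpM2l // addrC lerD //.
    have -> : expR (2 * b * r) = \sum_j \sum_i S j * x 0 i * expR (2 * b * r).
      under eq_bigr => j _ do rewrite -mulr_suml -mulr_sumr x1 mulr1.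
      by rewrite -mulr_suml S1 mul1r.
    apply: ler_sum => j _; apply: ler_sum => i _.
    rewrite ler_wpM2l ?mulr_ge0 // ler_expR.
    by rewrite (mulrC 2) -mulrA ler_wpM2l.
  rewrite mulrCA -mulrN ler_wpM2l // -mulNr.
  by apply: (drift_le R q S (fun k => x 0 k) d b c r) => //; exact/var/sum_deviation.
have {D0} : 0 <= \sum_(sigma in near_configs N x r) tilted_weight x b sigma *
   (expR (2 * b * r) - c / 2 * (N%:R * sq_deviation x sigma)).
  (* This factor, the only one with an explicit N, is common to all configurations and cancels. *)
  have e0 : 0 < 2 * expR (b / N%:R) by rewrite mulr_gt0 ?expR_gt0.
  rewrite -(pmulr_rge0 _ e0) mulr_sumr; apply: le_trans D0 _.
  by apply: ler_sum => sigma sA; rewrite mulrCA ler_wpM2l // DE.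
under eq_bigr => sigma _ do rewrite mulrBr (mulrCA _ (c / 2)).
rewrite sumrB -mulr_suml -mulr_sumr subr_ge0 => le.
rewrite -(ler_pM2l (divr_gt0 c0 (ltr0Sn R 1))); apply: (le_trans le).
by rewrite le_eqVlt; apply/orP; left; apply/eqP; field; rewrite gt_eqF.
Qed.

                                                       

(** * From second moments to the difference of two conditional means *)

(** Makes a function on the ball into one on all configurations, so that it can be composed with
    permutations; the filler 0 is never seen by sums over [A]. *)
Definition extend0 (R : realType) (T : finType) (A : {set T})
    (h : {t : T | t \in A} -> R) (t : T) : R :=
  if insub t is Some s then h s else 0.

Arguments extend0 {R T A} h t.

Lemma extend0E (R : realType) (T : finType) (A : {set T})
    (h : {t : T | t \in A} -> R) (s : {t : T | t \in A}) :
  extend0 h (val s) = h s.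
Proof. by rewrite /extend0 valK. Qed.

Lemma expect_conditional (R : realType) (T : finType) (p : T -> R)
    (A : {set T}) (h : {t : T | t \in A} -> R) :
  expect (conditional p A) h =
  (\sum_(t in A) p t * extend0 h t) / \sum_(t in A) p t.
Proof.
rewrite /expect /conditional mulr_suml.
rewrite [RHS](reindex_omap (fun s : {t | t \in A} => val s) insub); last first.
  by move=> t tA; rewrite (insubT (fun t => t \in A) tA).
apply: eq_big => [s|s _]; first by rewrite (valP s) valK eqxx.
by rewrite extend0E mulrAC.
Qed.

Lemma expect_conditional_scale (R : realType) (T : finType) (p p' : T -> R)
    (A : {set T}) (h : {t : T | t \in A} -> R) (C : R) : C != 0 ->
  (forall t, p t = C * p' t) ->
  expect (conditional p A) h = expect (conditional p' A) h.
Proof.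
move=> C0 pE; rewrite !expect_conditional.
rewrite (eq_bigr (fun t => C * (p' t * extend0 h t))); last first.
  by move=> t _; rewrite pE mulrA.
rewrite [X in _ / X](eq_bigr (fun t => C * p' t)) // -!mulr_sumr.
by rewrite -mulf_div divff // mul1r.
Qed.

Lemma lipschitz_supP (R : realType) (N q : nat) (A : {set config N q})
    (h : {sigma : config N q | sigma \in A} -> R) (sigma : config N q)
    (v : 'I_N) (i : 'I_q) :
  sigma \in A -> recolour sigma v i \in A ->
  `|extend0 h sigma - extend0 h (recolour sigma v i)| <= lipschitz_sup h.
Proof.
move=> sA rA; apply: (le_trans _ (le_bigmax _ _ v)).
pose s : {s | s \in A} := exist _ sigma sA.
pose t : {s | s \in A} := exist _ (recolour sigma v i) rA.
rewrite -[sigma]/(val s) -[recolour _ v i]/(val t) !extend0E.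
apply: ub_le_sup.
  (* Any upper bound will do: it makes [sup] a genuine supremum rather than a default value. *)
  exists (\sum_s \sum_t `|h s - h t|) => _ [s' [t' [_ ->]]].
  rewrite (bigD1 s') //= (bigD1 t') //= -addrA lerDl addr_ge0 ?sumr_ge0 // => u _.
  by rewrite sumr_ge0.
by exists s, t; split => // u /negPf uv; rewrite /= ffunE uv.
Qed.

Lemma lipschitz_sup_ge0 (R : realType) (N q : nat) (A : {set config N q})
    (h : {sigma : config N q | sigma \in A} -> R) : 0 <= lipschitz_sup h.
Proof. exact: bigmax_ge_id. Qed.

(** The path length is at most N times the l1 distance of the proportions; the arithmetic-geometric
    inequality trades this first-order quantity for phi at both ends, and this is where sqrt N
    appears. *)
Lemma symmetrise_deviation (R : realType) (N q : nat) (x : 'rV[R]_q) (r : R)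
    (H : config N q -> R) (L : R) (sigma tau : config N q) :
  (0 < N)%N -> 0 <= r -> 0 <= L ->
  (forall sigma v i, sigma \in near_configs N x r ->
    recolour sigma v i \in near_configs N x r ->
    `|H sigma - H (recolour sigma v i)| <= L) ->
  sigma \in near_configs N x r -> tau \in near_configs N x r ->
  `|symmetrise H sigma - symmetrise H tau| <=
  L * Num.sqrt N%:R / 2 *
  (2 * q%:R + N%:R * sq_deviation x sigma + N%:R * sq_deviation x tau).
Proof.
move=> N0 r0 L0 HL sA tA.
have NR0 : (0 : R) < N%:R by rewrite ltr0n.
apply: le_trans (symmetrise_near_lipschitz _ _ _ _ _ _ _ _ _ r0 HL sA tA) _.
rewrite -!mulrA ler_wpM2l //; set s := Num.sqrt _.
have s0 : 0 <= s by exact: sqrtr_ge0.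
have ss : s ^+ 2 = N%:R by rewrite sqr_sqrtr ?ltW.
have amgm (d : R) : N%:R * `|d| <= s / 2 * (1 + N%:R * d ^+ 2).
  rewrite -ss -(real_normK (num_real d)); move: (`|d|) => a; rewrite -subr_ge0.
  have -> : s / 2 * (1 + s ^+ 2 * a ^+ 2) - s ^+ 2 * a = s / 2 * (1 - s * a) ^+ 2.
    by field.
  by rewrite mulr_ge0 ?sqr_ge0 // divr_ge0.
have -> : s * (2^-1 * (2 * q%:R + N%:R * sq_deviation x sigma
    + N%:R * sq_deviation x tau)) =
    \sum_k (s / 2 * (1 + N%:R * deviation x sigma k ^+ 2)
         + s / 2 * (1 + N%:R * deviation x tau k ^+ 2)).
  rewrite big_split /= -!mulr_sumr !big_split /= -!mulr_sumr.
  by rewrite sumr_const card_ord; rewrite -/(sq_deviation _ _) -/(sq_deviation _ _); ring.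
rewrite natr_sum; apply: ler_sum => k _.
apply: le_trans (lerD (amgm _) (amgm _)).
rewrite -mulrDr; set n := colour_count tau k; set m := colour_count sigma k.
have le : (n - m)%:R <= `|n%:R - m%:R| :> R.
  have [nm|/ltnW mn] := leqP n m; first by rewrite (eqP nm) normr_ge0.
  by rewrite natrB // ler_norm.
have E : n%:R - m%:R = N%:R * (deviation x tau k - deviation x sigma k).
  by rewrite /deviation -/n -/m; field; rewrite gt_eqF.
apply: (le_trans le); rewrite E normrM ger0_norm ?ler0n // ler_wpM2l ?ler0n //.
by rewrite [leRHS]addrC ler_normB.
Qed.

(** The difference of means is the average of [H sigma - H tau] over independent draws from the two
    weights, to which [symmetrise_deviation] applies after symmetrisation. The factor 1/2 there
    turns 2q + M + M into q + M. *)
Lemma mean_difference_le (R : realType) (N q : nat) (x : 'rV[R]_q) (r : R)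
    (H W W' : config N q -> R) (L M : R) :
  (0 < N)%N -> 0 <= r -> 0 <= L ->
  (forall sigma v i, sigma \in near_configs N x r ->
    recolour sigma v i \in near_configs N x r ->
    `|H sigma - H (recolour sigma v i)| <= L) ->
  (forall sigma, 0 < W sigma) -> (forall sigma, 0 < W' sigma) ->
  (forall sigma p, W (shuffle sigma p) = W sigma) ->
  (forall sigma p, W' (shuffle sigma p) = W' sigma) ->
  \sum_(sigma in near_configs N x r) W sigma * (N%:R * sq_deviation x sigma) <=
    M * \sum_(sigma in near_configs N x r) W sigma ->
  \sum_(sigma in near_configs N x r) W' sigma * (N%:R * sq_deviation x sigma) <=
    M * \sum_(sigma in near_configs N x r) W' sigma ->
  `|(\sum_(sigma in near_configs N x r) W sigma * H sigma) /
      (\sum_(sigma in near_configs N x r) W sigma) -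
    (\sum_(sigma in near_configs N x r) W' sigma * H sigma) /
      (\sum_(sigma in near_configs N x r) W' sigma)| <=
  L * (q%:R + `|M|) * Num.sqrt N%:R.
Proof.
move=> N0 r0 L0 HL W0 W'0 WS W'S; set A := near_configs N x r in HL *.
(* On an empty ball both quotients are 0 by the convention on division. *)
have [->|[s0 s0A]] := set_0Vmem A.
  by rewrite !big_set0 !mul0r subrr normr0 => _ _; rewrite !mulr_ge0 ?addr_ge0 ?sqrtr_ge0.
have AS := near_configs_shuffle R N q x r; rewrite -/A in AS.
rewrite -(sum_symmetrise _ _ _ A W H AS WS) -(sum_symmetrise _ _ _ A W' H AS W'S).
set Z := \sum_(sigma in A) W sigma; set Z' := \sum_(sigma in A) W' sigma.
set m := \sum_(sigma in A) W sigma * (_ * _); set m' := \sum_(sigma in A) W' sigma * (_ * _).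
have Z0 : 0 < Z by rewrite /Z (bigD1 s0) //= ltr_wpDr ?sumr_ge0 // => s _; exact: ltW.
have Z'0 : 0 < Z' by rewrite /Z' (bigD1 s0) //= ltr_wpDr ?sumr_ge0 // => s _; exact: ltW.
move=> mM m'M; set h := symmetrise H.
have -> : (\sum_(s in A) W s * h s) / Z - (\sum_(s in A) W' s * h s) / Z' =
    (\sum_(s in A) \sum_(t in A) W s * W' t * (h s - h t)) / (Z * Z').
  have -> : \sum_(s in A) \sum_(t in A) W s * W' t * (h s - h t) =
      (\sum_(s in A) W s * h s) * Z' - Z * \sum_(t in A) W' t * h t.
    rewrite !mulr_suml -sumrB; apply: eq_bigr => s _.
    by rewrite !mulr_sumr -sumrB; apply: eq_bigr => t _; ring.
  by field; rewrite !gt_eqF.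
have ZZ0 : 0 < Z * Z' by rewrite mulr_gt0.
rewrite normrM normfV (gtr0_norm ZZ0) ler_pdivrMr //.
apply: (@le_trans _ _ (\sum_(s in A) \sum_(t in A) W s * W' t *
  (L * Num.sqrt N%:R / 2 *
  (2 * q%:R + N%:R * sq_deviation x s + N%:R * sq_deviation x t)))).
  apply: (le_trans (ler_norm_sum _ _ _)); apply: ler_sum => s sA.
  apply: (le_trans (ler_norm_sum _ _ _)); apply: ler_sum => t tA.
  have WW : 0 < W s * W' t by rewrite mulr_gt0.
  rewrite normrM (gtr0_norm WW) ler_wpM2l ?(ltW WW) //.
  exact: (symmetrise_deviation R N q x r H L s t N0 r0 L0 HL sA tA).
have -> : \sum_(s in A) \sum_(t in A) W s * W' t *
  (L * Num.sqrt N%:R / 2 *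
  (2 * q%:R + N%:R * sq_deviation x s + N%:R * sq_deviation x t)) =
  L * Num.sqrt N%:R / 2 * (2 * q%:R * (Z * Z') + m * Z' + Z * m').
  have -> : 2 * q%:R * (Z * Z') + m * Z' + Z * m' = \sum_(s in A)
      (W s * (2 * q%:R + N%:R * sq_deviation x s) * Z' + W s * m').
    rewrite big_split /= -!mulr_suml -/Z; congr (_ + _).
    rewrite (mulrA _ Z) -mulrDl; congr (_ * _); rewrite mulr_sumr -big_split /=.
    by apply: eq_bigr => s _; ring.
  rewrite mulr_sumr; apply: eq_bigr => s _; rewrite /Z' /m'.
  move: (N%:R * sq_deviation x s) => a; rewrite 2!mulr_sumr.
  by rewrite -big_split mulr_sumr /=; apply: eq_bigr => t _; ring.
have M1 : m * Z' <= `|M| * (Z * Z').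
  rewrite mulrA ler_wpM2r ?(ltW Z'0) // (le_trans mM) // ler_wpM2r ?(ltW Z0) //; exact: ler_norm.
have M2 : Z * m' <= `|M| * (Z * Z').
  rewrite mulrCA ler_wpM2l ?(ltW Z0) // (le_trans m'M) // ler_wpM2r ?(ltW Z'0) //; exact: ler_norm.
have sL : 0 <= L * Num.sqrt N%:R / 2 by rewrite divr_ge0 // mulr_ge0 ?sqrtr_ge0.
apply: le_trans (ler_wpM2l sL (lerD (lerD (lexx _) M1) M2)) _.
by rewrite le_eqVlt; apply/orP; left; apply/eqP; field.
Qed.

Lemma tilted_weight_shuffle (R : realType) (N q : nat) (x : 'rV[R]_q) (b : R)
    (sigma : config N q) (p : {perm 'I_N}) :
  tilted_weight x b (shuffle sigma p) = tilted_weight x b sigma.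
Proof.
rewrite /tilted_weight sq_deviation_shuffle; congr (_ * _).
rewrite /product_measure [RHS](reindex_inj (@perm_inj _ p)).
by apply: eq_bigr => v _; rewrite ffunE.
Qed.

Lemma tilted_weight0 (R : realType) (N q : nat) (x : 'rV[R]_q)
    (sigma : config N q) : tilted_weight x 0 sigma = product_measure x sigma.
Proof. by rewrite /tilted_weight mul0r expR0 mulr1. Qed.

Lemma tilted_weight_gt0 (R : realType) (N q : nat) (x : 'rV[R]_q) (b : R)
    (sigma : config N q) : (forall k, 0 < x 0 k) -> 0 < tilted_weight x b sigma.
Proof. by move=> x0; rewrite mulr_gt0 ?expR_gt0 // prodr_gt0. Qed.

Lemma hamiltonianE (R : realType) (N q : nat) (sigma : config N q) :
  hamiltonian R sigma = - (N%:R^-1 * \sum_k (colour_count sigma k)%:R ^+ 2).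
Proof.
rewrite /hamiltonian; congr (- (_ * _)).
rewrite (eq_bigr (fun u => (colour_count sigma (sigma u))%:R)); last first.
  by move=> u _; rewrite colour_countE natr_sum; apply: eq_bigr => v _; rewrite eq_sym.
by rewrite (sum_colour_count R N q sigma (fun k => (colour_count sigma k)%:R)).
Qed.

                                                                              
                                           
(** By the fixed-point equation the product weight is exp(2 beta N <S, x>) / z^N. The linear term
    cancels that of beta N |S - x|^2, leaving beta N |S|^2 = -beta H and a constant. *)
Lemma potts_tilted_weight (R : realType) (N q : nat) (x : 'rV[R]_q)
    (beta z : R) : (0 < N)%N -> 0 < z ->
  (forall k, x 0 k = expR (2 * beta * x 0 k) / z) ->
  exists2 C : R, 0 < C &
  forall sigma : config N q, potts beta sigma = C * tilted_weight x beta sigma.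
Proof.
move=> N0 z0 xE; have NR0 : (N%:R : R) != 0 by rewrite pnatr_eq0 -lt0n.
pose Z := partition_function N q beta.
pose X := \sum_k x 0 k ^+ 2.
have Z0 : 0 <= Z by apply: sumr_ge0 => s _; exact: expR_ge0.
have tE (sigma : config N q) : tilted_weight x beta sigma =
    expR (- beta * hamiltonian R sigma) * (expR (beta * N%:R * X) / z ^+ N).
  rewrite /tilted_weight /product_measure.
  rewrite (eq_bigr (fun v => expR (2 * beta * x 0 (sigma v)) * z^-1)); last first.
    by move=> v _; rewrite -xE.
  rewrite big_split /= prodr_const card_ord exprVn -expR_sum mulrAC [RHS]mulrA.
  congr (_ / _); rewrite -!expRD; congr expR.
  rewrite (sum_colour_count R N q sigma (fun k => 2 * beta * x 0 k)) hamiltonianE.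
  rewrite /sq_deviation /X !(mulrN, mulNr) opprK !mulr_sumr -!big_split /=.
  by apply: eq_bigr => k _; rewrite /deviation; field.
(* The partition function vanishes only when there is no configuration at all; any constant then
   serves. *)
have [Z00|Zn0] := eqVneq Z 0.
  exists 1 => // sigma; have : expR (- beta * hamiltonian R sigma) <= Z.
    rewrite /Z /partition_function (bigD1 sigma) //= lerDl.
    by apply: sumr_ge0 => s _; exact: expR_ge0.
  by rewrite Z00 leNgt expR_gt0.
have Zgt0 : 0 < Z by rewrite lt0r Zn0.
exists (z ^+ N / expR (beta * N%:R * X) / Z).
  by rewrite !divr_gt0 ?exprn_gt0 ?expR_gt0.
move=> sigma; rewrite tE /potts -/Z; field.
by rewrite Zn0 !gt_eqF ?exprn_gt0 ?expR_gt0.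
Qed.

                                         

(** * Elementary inequalities for logarithm, logit and exponential *)

Lemma ln_lt_sub1 (R : realType) (t : R) : 0 < t -> t != 1 -> ln t < t - 1.
Proof.
move=> t0 t1; rewrite ltrBrDl -{2}(lnK (x := t)) ?posrE //.
by apply: expR_gt1Dx; rewrite ln_eq0.
Qed.

Lemma is_derive_logit (R : realType) (t : R) : 0 < t < 1 ->
  is_derive t 1 (fun t : R => ln t - ln (1 - t)) (t^-1 + (1 - t)^-1).
Proof.
move=> /andP[t0 t1]; have t10 : 0 < 1 - t by rewrite subr_gt0.
have D := is_derive1_ln t0.
have D' : is_derive t 1 (fun t : R => ln (1 - t)) (- (1 - t)^-1).
  apply: (is_derive_eq (is_derive1_comp (f := @ln R) (g := fun t => 1 - t)
    (is_derive1_ln t10) _)).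
  by rewrite add0r mul1r mulrN1.
by apply: is_derive_eq; rewrite opprK.
Qed.

Lemma MVT_is_derive (R : realType) (f df : R -> R) (a b : R) : a < b ->
  (forall t, a <= t <= b -> is_derive t 1 f (df t)) ->
  exists2 c, a < c < b & f b - f a = df c * (b - a).
Proof.
move=> ab D; have [||c] := @MVT R f df a b ab.
- by move=> t; rewrite in_itv /= => /andP[at_ tb]; apply: D; rewrite !ltW.
- apply: derivable_within_continuous => t; rewrite in_itv /= => tI.
  by have [] := D t tI.
- by rewrite in_itv /= => cI fE; exists c.
Qed.

(** t^2 - 2 t ln t has derivative 2 (t - 1 - ln t), positive for t > 1; compare with its value at 1
    and divide by w. *)
Lemma ln_lt_half_sub_inv (R : realType) (w : R) : 1 < w -> 2 * ln w < w - w^-1.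
Proof.
move=> w1; have w0 : 0 < w by rewrite (lt_trans _ w1).
pose f (t : R) := t ^+ 2 - 2 * (t * ln t).
have D (t : R) : 1 <= t <= w -> is_derive t 1 f (2 * (t - 1 - ln t)).
  move=> /andP[t1 _]; have t0 : 0 < t by rewrite (lt_le_trans _ t1).
  have D := is_derive1_ln t0.
  by apply: is_derive_eq; rewrite /GRing.scale /=; field; rewrite gt_eqF.
have [c /andP[c1 _] fE] := MVT_is_derive _ _ _ _ _ w1 D.
have : 0 < f w - f 1.
  rewrite fE mulr_gt0 ?subr_gt0 // mulr_gt0 // ?subr_gt0.
  by rewrite ln_lt_sub1 ?gt_eqF // (lt_trans _ c1).
rewrite /f ln1 mulr0 mulr0 subr0 expr1n => pos.
rewrite -(ltr_pM2l w0) mulrBr divff ?gt_eqF //; lra.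
Qed.

Lemma ln_gt_rational (R : realType) (w : R) : 1 < w ->
  2 * (w - 1) < (w + 1) * ln w.
Proof.
move=> w1; pose f (t : R) := (t + 1) * ln t - 2 * t.
have D (t : R) : 1 <= t <= w -> is_derive t 1 f (ln t + t^-1 - 1).
  move=> /andP[t1 _]; have t0 : 0 < t by rewrite (lt_le_trans _ t1).
  have D := is_derive1_ln t0.
  by apply: is_derive_eq; rewrite /GRing.scale /=; field; rewrite gt_eqF.
have [c /andP[c1 _] fE] := MVT_is_derive _ _ _ _ _ w1 D.
have c0 : 0 < c by rewrite (lt_trans _ c1).
have : 0 < f w - f 1.
  rewrite fE mulr_gt0 ?subr_gt0 //.
  have := ln_lt_sub1 R c^-1; rewrite invr_gt0 c0 invr_eq1 gt_eqF // lnV ?posrE //.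
  by move=> /(_ isT isT); lra.
rewrite /f ln1; lra.
Qed.

(** The logit has slope 1/(t(1 - t)). Two consecutive chords of slope 1/K give points c < v < c'
    with c(1 - c) = c'(1 - c') = K, hence c + c' = 1, and t(1 - t) exceeds K strictly between
    them. *)
Lemma logit_two_chords (R : realType) (p v v' K : R) :
  0 < p -> p < v -> v < v' -> v' < 1 -> 0 < K ->
  (ln v - ln (1 - v)) - (ln p - ln (1 - p)) = (v - p) / K ->
  (ln v' - ln (1 - v')) - (ln v - ln (1 - v)) = (v' - v) / K ->
  K < v * (1 - v).
Proof.
move=> p0 pv vv' v'1 K0 E E'.
have chord (a b : R) : 0 < a -> a < b -> b < 1 ->
    (ln b - ln (1 - b)) - (ln a - ln (1 - a)) = (b - a) / K ->
    exists2 c, a < c < b & c * (1 - c) = K.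
  move=> a0 ab b1 abE.
  have [|c cI cE] := MVT_is_derive _ (fun t => ln t - ln (1 - t))
    (fun t => t^-1 + (1 - t)^-1) a b ab.
    move=> t /andP[at_ tb]; apply: is_derive_logit.
    by rewrite (lt_le_trans a0) //= (le_lt_trans tb).
  exists c => //; move: cE; rewrite abE => /eqP; rewrite mulrC.
  have ba0 : b - a != 0 by rewrite subr_eq0 gt_eqF.
  rewrite (inj_eq (mulIf ba0)) => /eqP /(congr1 GRing.inv); rewrite invrK => ->.
  move: cI => /andP[ac cb].
  have c0 : c != 0 by rewrite gt_eqF // (lt_trans a0).
  have c1 : 1 - c != 0 by rewrite gt_eqF // subr_gt0 (lt_trans cb).
  have -> : c^-1 + (1 - c)^-1 = (c * (1 - c))^-1 by field; rewrite c0 c1.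
  by rewrite invrK.
have [c /andP[pc cv] cE] := chord p v p0 pv (lt_trans vv' v'1) E.
have [c' /andP[vc' c'v'] c'E] := chord v v' (lt_trans p0 pv) vv' v'1 E'.
have cc' : c < c' by exact: lt_trans vc'.
have s1 : c + c' = 1.
  have /eqP : (c' - c) * (1 - (c + c')) = 0.
    have -> : (c' - c) * (1 - (c + c')) = c' * (1 - c') - c * (1 - c) by ring.
    by rewrite cE c'E subrr.
  by rewrite mulf_eq0 subr_eq0 gt_eqF //= subr_eq0 => /eqP.
rewrite -subr_gt0 -cE; have -> : v * (1 - v) - c * (1 - c) = (v - c) * (c' - v).
  have -> : c' = 1 - c by lra.
  by ring.
by rewrite mulr_gt0 ?subr_gt0.
Qed.

(** Comparison of the y^2 coefficients at 0, done with one explicit small y. It extracts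
    second-order conditions without derivatives. *)
Lemma cosh_second_order (R : realType) (a c : R) : 0 <= c ->
  (forall y, 0 < y -> a * (expR y + expR (- y) - 2) <= expR (c * y ^+ 2) - 1) ->
  a <= c.
Proof.
move=> c0 H; rewrite leNgt; apply/negP => ca.
have a0 : 0 < a by exact: le_lt_trans ca.
(* Chosen so that the Taylor errors, at most y (a + 2 a^2) after division by y^2, amount to only
   half of a - c. *)
pose y := (a - c) / (2 * (a + 2 * a ^+ 2)).
have d0 : 0 < 2 * (a + 2 * a ^+ 2).
  by rewrite mulr_gt0 // addr_gt0 // mulr_gt0 // exprn_gt0.
have y0 : 0 < y by rewrite divr_gt0 // subr_gt0.
have yE : 2 * y * (a + 2 * a ^+ 2) = a - c by rewrite (mulrC 2) -mulrA /y divfK ?gt_eqF.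
have y_le : 2 * y * (1 + 2 * a) <= 1.
  rewrite -(ler_pM2l a0) mulr1.
  have -> : a * (2 * y * (1 + 2 * a)) = 2 * y * (a + 2 * a ^+ 2) by ring.
  by rewrite yE gerBl.
have ay0 : 0 < a * y by rewrite mulr_gt0.
have y2 : y <= 1 / 2 by lra.
have cosh : y ^+ 2 * (1 - y) <= expR y + expR (- y) - 2.
  have -> : expR y + expR (- y) - 2 = expR (- y) * (expR y - 1) ^+ 2.
    by rewrite expRN; field; rewrite gt_eqF ?expR_gt0.
  rewrite mulrC ler_pM ?sqr_ge0 //; first lra.
    by have := expR_ge1Dx (- y); lra.
  by rewrite ler_sqr ?nnegrE; have := expR_ge1Dx y; lra.
have cay : c * y <= a * y by rewrite ler_wpM2r // ltW.
have cy0 : 0 <= c * y by rewrite mulr_ge0 // ltW.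
have cyy0 : 0 <= c * y ^+ 2 by rewrite mulr_ge0 ?sqr_ge0.
have cyy : c * y ^+ 2 <= 1 / 2.
  have -> : c * y ^+ 2 = c * y * y by ring.
  have : c * y * y <= 1 / 4 * (1 / 2) by rewrite ler_pM // ?ltW //; lra.
  by lra.
have := le_trans (ler_wpM2l (ltW a0) cosh) (H y y0).
move=> /le_trans/(_ (lerB (expR_le_quadratic R _ cyy0 cyy) (lexx 1))).
have -> : 1 + c * y ^+ 2 + 2 * (c * y ^+ 2) ^+ 2 - 1 =
  y ^+ 2 * (c + 2 * (c * y * (c * y))) by ring.
rewrite mulrCA ler_pM2l ?exprn_gt0 // => le.
have : c * y * (c * y) <= a * y * a.
  rewrite ler_pM //; have : c * y <= c * 1; last by lra.
  by rewrite ler_wpM2l //; lra.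
lra.
Qed.

(** * Critical equation and shape of the macrostates *)

Lemma sum_exp_gt0 (R : realType) (q : nat) (f : 'I_q -> R) : (0 < q)%N ->
  0 < \sum_i expR (f i).
Proof.
case: q f => // n f _; rewrite big_ord_recl ltr_wpDr ?expR_gt0 //.
by rewrite sumr_ge0 // => i _; exact: expR_ge0.
Qed.

(** The inequality G(x) <= G(x + s), exponentiated: a sub-Gaussian bound on the softmax law of x,
    valid for all s and not only small ones. *)
Lemma macrostate_softmax_le (R : realType) (q : nat) (beta : R) (x : 'rV[R]_q)
    (s : 'I_q -> R) : (0 < q)%N -> macrostates q beta x ->
  \sum_i expR (2 * beta * x 0 i) / (\sum_j expR (2 * beta * x 0 j)) *
    expR (2 * beta * s i) <=
  expR (2 * beta * (\sum_i x 0 i * s i) + beta * \sum_i s i ^+ 2).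
Proof.
move=> q0 /(_ (\row_i (x 0 i + s i))); rewrite /free_energy.
have n2 (t : 'rV[R]_q) : norm2 t ^+ 2 = \sum_i t 0 i ^+ 2.
  by rewrite sqr_sqrtr // sumr_ge0 // => i _; exact: sqr_ge0.
have pos (f : 'I_q -> R) := sum_exp_gt0 R q f q0.
rewrite !n2; have -> : \sum_i (\row_i (x 0 i + s i)) 0 i ^+ 2 =
    \sum_i (x 0 i + s i) ^+ 2 by apply: eq_bigr => i _; rewrite mxE.
have -> : \sum_i expR (2 * beta * (\row_i (x 0 i + s i)) 0 i) =
    \sum_i expR (2 * beta * (x 0 i + s i)) by apply: eq_bigr => i _; rewrite mxE.
set Z := \sum_i expR (2 * beta * x 0 i); set Z' := \sum_i expR (2 * beta * (_ + _)) => le.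
have -> : \sum_i expR (2 * beta * x 0 i) / Z * expR (2 * beta * s i) = Z' / Z.
  rewrite mulr_suml; apply: eq_bigr => i _.
  by rewrite mulrAC -expRD; congr (expR _ / _); ring.
rewrite -ler_ln ?posrE ?divr_gt0 ?pos ?expR_gt0 // expRK.
rewrite lnM ?posrE ?invr_gt0 ?pos // lnV ?posrE ?pos //.
have E : \sum_i (x 0 i + s i) ^+ 2 =
    \sum_i x 0 i ^+ 2 + 2 * (\sum_i x 0 i * s i) + \sum_i s i ^+ 2.
  by rewrite mulr_sumr -!big_split /=; apply: eq_bigr => i _; ring.
by move: le; rewrite E; lra.
Qed.

                                                                                
                                                                                
(** Take s = p - x with p the softmax of x. Jensen bounds the left side of [macrostate_softmax_le]
    below by exp(2 beta <p, s>), whence 2 beta |s|^2 <= beta |s|^2 and s = 0. *)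
Lemma macrostate_critical (R : realType) (q : nat) (beta : R) (x : 'rV[R]_q) :
  (0 < q)%N -> 0 < beta -> macrostates q beta x -> forall i,
  x 0 i = expR (2 * beta * x 0 i) / \sum_j expR (2 * beta * x 0 j).
Proof.
move=> q0 b0 xM.
pose p i := expR (2 * beta * x 0 i) / \sum_j expR (2 * beta * x 0 j).
pose s i := p i - x 0 i.
have Z0 := sum_exp_gt0 R q (fun j => 2 * beta * x 0 j) q0.
have p1 : \sum_i p i = 1 by rewrite -mulr_suml divff ?gt_eqF.
have p0 i : 0 <= p i by rewrite divr_ge0 ?expR_ge0 // ltW.
have := macrostate_softmax_le R q beta x s q0 xM.
set m := 2 * beta * \sum_i p i * s i.
have jensen : expR m <= \sum_i p i * expR (2 * beta * s i).
  have -> : expR m = \sum_i p i * (expR m * (1 + (2 * beta * s i - m))).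
    transitivity (expR m * ((1 - m) * (\sum_i p i) +
      2 * beta * \sum_i p i * s i)); first by rewrite p1 -/m; ring.
    move: (m) => m'; rewrite !mulr_sumr -big_split mulr_sumr /=.
    by apply: eq_bigr => i _; ring.
  apply: ler_sum => i _; rewrite ler_wpM2l //.
  rewrite -[2 * beta * s i](subrKC m) expRD ler_wpM2l ?expR_ge0 //.
  by rewrite (addrC m) addrK expR_ge1Dx.
move=> /(le_trans jensen); rewrite ler_expR /m => le.
have Q0 : \sum_i s i ^+ 2 = 0.
  apply/eqP; rewrite eq_le sumr_ge0 ?andbT; last by move=> i _; exact: sqr_ge0.
  have E : \sum_i s i ^+ 2 = \sum_i p i * s i - \sum_i x 0 i * s i.
    by rewrite -sumrB; apply: eq_bigr => i _; rewrite /s; ring.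
  have : beta * \sum_i s i ^+ 2 <= beta * 0 by move: le; rewrite mulr0 E; lra.
  by rewrite ler_pM2l.
move=> i; apply/esym/eqP; rewrite -subr_eq0 -sqrf_eq0 eq_le sqr_ge0 andbT.
have : s i ^+ 2 <= \sum_j s j ^+ 2; last by rewrite Q0.
by rewrite (bigD1 i) //= lerDl; apply: sumr_ge0 => j _; exact: sqr_ge0.
Qed.

(** The chord of ln over [a, b] has slope strictly between 1/b and 1/a. *)
Lemma log_chord_bounds (R : realType) (beta a b : R) : 0 < a -> a < b ->
  ln b - ln a = 2 * beta * (b - a) -> 2 * beta * a < 1 < 2 * beta * b.
Proof.
move=> a0 ab E; have b0 : 0 < b by exact: lt_trans ab.
have ba0 : 0 < b - a by rewrite subr_gt0.
have [an bn] : a != 0 /\ b != 0 by rewrite !gt_eqF.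
apply/andP; split; rewrite -(ltr_pM2r ba0) mul1r.
  have : ln (b / a) < b / a - 1.
    apply: ln_lt_sub1; rewrite ?divr_gt0 // -subr_eq0 -[1](divff an) -mulrBl.
    by rewrite mulf_neq0 ?invr_eq0 ?gt_eqF.
  rewrite lnM ?posrE ?invr_gt0 // lnV ?posrE // E => lt.
  rewrite -(ltr_pM2l a0) in lt; move: lt.
  have -> : a * (b / a - 1) = b - a by field.
  lra.
have : ln (a / b) < a / b - 1.
  apply: ln_lt_sub1; rewrite ?divr_gt0 // -subr_eq0 -[1](divff bn) -mulrBl.
  rewrite mulf_neq0 ?invr_eq0 //.
  by rewrite lt_eqF // subr_lt0.
rewrite lnM ?posrE ?invr_gt0 // lnV ?posrE // => lt.
rewrite -(ltr_pM2l b0) in lt; move: lt.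
have -> : b * (a / b - 1) = a - b by field.
have -> : ln a - ln b = - (2 * beta * (b - a)) by rewrite -E; ring.
lra.
Qed.

                                                                               
                                                                     
(** At y = 2 ln((1 - v)/v), the extremal point for the sub-Gaussian constant of a Bernoulli law, the
    left side collapses to (1 - v)/v. With L = y/2 the hypothesis reads L (1 - 2v) <= 2 K L^2, and
    [ln_lt_half_sub_inv] gives 2 v (1 - v) L^2 < L (1 - 2v). *)
Lemma bernoulli_variance_lt (R : realType) (v K : R) : 0 < v < 1 -> v != 1 / 2 ->
  (forall y, 1 - v + v * expR y <= expR (v * y + K / 2 * y ^+ 2)) ->
  v * (1 - v) < K.
Proof.
move=> /andP[v0 v1] v2 H; have v10 : 0 < 1 - v by rewrite subr_gt0.
have [vn v1n] : v != 0 /\ 1 - v != 0 by rewrite !gt_eqF.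
pose w := (1 - v) / v; have w0 : 0 < w by rewrite divr_gt0.
pose L := ln w; have := H (L + L); rewrite expRD lnK ?posrE //.
have -> : 1 - v + v * (w * w) = expR L by rewrite lnK ?posrE // /w; field.
rewrite ler_expR => le.
have w1 : w != 1.
  apply: contra_neq v2 => e; have : w * v = v by rewrite e mul1r.
  by rewrite /w divfK //; lra.
have wE : v * (1 - v) * (w - w^-1) = 1 - 2 * v.
  by rewrite /w; field; rewrite v1n vn.
have vv0 : 0 < v * (1 - v) by rewrite mulr_gt0.
have L2 : 0 < L ^+ 2 by rewrite exprn_even_gt0 //= ln_eq0.
have L20 : 0 < 2 * L ^+ 2 by rewrite mulr_gt0.
rewrite -(ltr_pM2r L20).
apply: (@lt_le_trans _ _ (L * (1 - 2 * v))); last first.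
  by rewrite -subr_ge0; move: le; rewrite -subr_ge0; congr (0 <= _); field.
rewrite -wE; have [lt|gt|/eqP] := ltgtP w 1; last by rewrite (negPf w1).
  have L0 : 0 < - L by rewrite oppr_gt0 ln_lt0 // w0.
  have := ln_lt_half_sub_inv R w^-1; rewrite invf_gt1 // => /(_ lt).
  rewrite lnV ?posrE // invrK -/L => lt'.
  rewrite -(ltr_pM2l (mulr_gt0 vv0 L0)) in lt'; move: lt'; lra.
have L0 : 0 < L by rewrite ln_gt0.
have := ln_lt_half_sub_inv R w gt; rewrite -/L => lt'.
rewrite -(ltr_pM2l (mulr_gt0 vv0 L0)) in lt'; move: lt'; lra.
Qed.

                                                                               
                                                                              
                                                       
(** Here v is the distinguished coordinate and u = (1 - v)/(q - 1) the common value of the others.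
    The equation is criticality; the last clause is the strict second-order condition, q v u being
    the variance-to-norm ratio in the direction (q - 1, -1, ..., -1). *)
Definition macrostate_value (R : realType) (q : nat) (beta v : R) : Prop :=
  [/\ q%:R^-1 <= v, v < 1,
      ln v - ln ((1 - v) / (q%:R - 1)) = 2 * beta * (v - (1 - v) / (q%:R - 1)) &
      2 * beta * q%:R * v * ((1 - v) / (q%:R - 1)) < 1].

Arguments macrostate_value {R} q beta v.

Lemma macrostate_le (R : realType) (q : nat) (beta : R) (x : 'rV[R]_q)
    (s : 'I_q -> R) : (0 < q)%N -> 0 < beta -> macrostates q beta x ->
  \sum_i x 0 i * expR (2 * beta * s i) <=
  expR (2 * beta * (\sum_i x 0 i * s i) + beta * \sum_i s i ^+ 2).
Proof.
move=> q0 b0 xM; apply: le_trans (macrostate_softmax_le _ _ _ _ s q0 xM).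
rewrite le_eqVlt; apply/orP; left; apply/eqP; apply: eq_bigr => i _.
by rewrite -macrostate_critical.
Qed.

Lemma macrostate_gt0 (R : realType) (q : nat) (beta : R) (x : 'rV[R]_q) :
  (0 < q)%N -> 0 < beta -> macrostates q beta x -> forall i, 0 < x 0 i.
Proof.
move=> q0 b0 xM i; rewrite (macrostate_critical _ _ _ _ q0 b0 xM).
by rewrite divr_gt0 ?expR_gt0 ?sum_exp_gt0.
Qed.

Lemma macrostate_sum1 (R : realType) (q : nat) (beta : R) (x : 'rV[R]_q) :
  (0 < q)%N -> 0 < beta -> macrostates q beta x -> \sum_i x 0 i = 1.
Proof.
move=> q0 b0 xM; have crit := macrostate_critical _ _ _ _ q0 b0 xM.
by rewrite (eq_bigr _ (fun i _ => crit i)) -mulr_suml divff // gt_eqF ?sum_exp_gt0.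
Qed.

Lemma macrostate_ln (R : realType) (q : nat) (beta : R) (x : 'rV[R]_q) :
  (0 < q)%N -> 0 < beta -> macrostates q beta x -> forall i j,
  ln (x 0 i) - ln (x 0 j) = 2 * beta * (x 0 i - x 0 j).
Proof.
move=> q0 b0 xM i j; have crit := macrostate_critical _ _ _ _ q0 b0 xM.
rewrite {1}(crit i) {1}(crit j).
rewrite !lnM ?posrE ?expR_gt0 ?invr_gt0 ?sum_exp_gt0 // !expRK; ring.
Qed.

Lemma sum_two_points (R : pzRingType) (q : nat) (i j : 'I_q) (f : 'I_q -> R) :
  i != j -> (forall k, k != i -> k != j -> f k = 0) -> \sum_k f k = f i + f j.
Proof.
move=> ij f0; rewrite (bigD1 i) //= (bigD1 j) 1?eq_sym //= big1 ?addr0 // => k.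
by move=> /andP[]; exact: f0.
Qed.

(** Second-order condition in the direction e_i - e_j, along which the cosh of [cosh_second_order]
    appears. *)
Lemma macrostate_pair_le (R : realType) (q : nat) (beta : R) (x : 'rV[R]_q)
    (i j : 'I_q) : 0 < beta -> macrostates q beta x -> i != j ->
  x 0 i = x 0 j -> 2 * beta * x 0 i <= 1.
Proof.
move=> b0 xM ij xij; have q0 : (0 < q)%N by rewrite (leq_ltn_trans _ (ltn_ord i)).
have b20 : 0 < 2 * beta by rewrite mulr_gt0.
suff : x 0 i <= (2 * beta)^-1.
  by rewrite -(ler_pM2l b20) divff ?gt_eqF.
apply: cosh_second_order => [|y y0]; first by rewrite invr_ge0 ltW.
pose t := y / (2 * beta).
pose s k := t * ((k == i)%:R - (k == j)%:R).
have si : s i = t by rewrite /s eqxx (negPf ij) subr0 mulr1.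
have sj : s j = - t by rewrite /s eqxx eq_sym (negPf ij) sub0r mulrN1.
have s0 k : k != i -> k != j -> s k = 0.
  by move=> /negPf ki /negPf kj; rewrite /s ki kj subrr mulr0.
have := macrostate_le R q beta x s q0 b0 xM.
rewrite (sum_two_points _ _ i j (fun k => x 0 k * s k)) //; last first.
  by move=> k ki kj; rewrite s0 ?mulr0.
rewrite (sum_two_points _ _ i j (fun k => s k ^+ 2)) //; last first.
  by move=> k ki kj; rewrite s0 // expr0n.
have -> : \sum_k x 0 k * expR (2 * beta * s k) =
    \sum_k x 0 k + \sum_k x 0 k * (expR (2 * beta * s k) - 1).
  by rewrite -big_split /=; apply: eq_bigr => k _; ring.
rewrite (sum_two_points _ _ i j (fun k => x 0 k * (expR (2 * beta * s k) - 1))) //; last first.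
  by move=> k ki kj; rewrite s0 // mulr0 expR0 subrr mulr0.
rewrite (macrostate_sum1 _ _ _ _ q0 b0 xM) si sj xij.
have -> : 2 * beta * t = y by rewrite mulrC divfK // gt_eqF.
have -> : 2 * beta * - t = - y by rewrite mulrN mulrC divfK // gt_eqF.
have -> : 2 * beta * (x 0 j * t + x 0 j * - t) + beta * (t ^+ 2 + (- t) ^+ 2) =
   (2 * beta)^-1 * y ^+ 2 by rewrite /t; field; rewrite gt_eqF.
lra.
Qed.

(** By [log_chord_bounds] two distinct coordinates lie on opposite sides of 1/(2 beta), so at most
    two values occur; by [macrostate_pair_le] a value above 1/(2 beta) occurs only once. *)
Lemma macrostate_shape (R : realType) (q : nat) (beta : R) (x : 'rV[R]_q) :
  (0 < q)%N -> 0 < beta -> macrostates q beta x ->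
  exists k u, u <= x 0 k /\ forall i, i != k -> x 0 i = u.
Proof.
move=> q0 b0 xM; have x0 := macrostate_gt0 _ _ _ _ q0 b0 xM.
have xln := macrostate_ln _ _ _ _ q0 b0 xM.
have bounds i j := log_chord_bounds R beta (x 0 i) (x 0 j) (x0 i).
have [k kmax] : exists k, forall i, x 0 i <= x 0 k.
  case: q q0 x {xM} x0 xln bounds => // n _ x _ _ _.
  have [k _ kP] := arg_maxP (fun i => x 0 i) (isT : predT (ord0 : 'I_n.+1)).
  by exists k => i; exact: kP.
have [/existsP[i ik]|/existsPn all] := boolP [exists i, x 0 i < x 0 k]; last first.
  exists k, (x 0 k); split => // i _; apply/eqP.
  by rewrite eq_le kmax leNgt all.
have /andP[_ vb] := bounds i k ik (xln k i).
exists k, (x 0 i); split => [|j jk]; first exact: ltW.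
have jlt : x 0 j < x 0 k.
  rewrite lt_neqAle kmax andbT; apply/eqP => e.
  have := macrostate_pair_le R q beta x j k b0 xM jk e.
  by rewrite e leNgt vb.
have [lt|lt|//] := ltgtP (x 0 j) (x 0 i).
  have /andP[_ lo] := bounds j i lt (xln i j).
  by have /andP[hi _] := bounds i k ik (xln k i); rewrite ltNge ltW in lo.
have /andP[_ lo] := bounds i j lt (xln j i).
by have /andP[hi _] := bounds j k jlt (xln k j); rewrite ltNge ltW in lo.
Qed.

Lemma sum_one_special (R : pzRingType) (q : nat) (k : 'I_q) (f : 'I_q -> R) (a : R) :
  (forall i, i != k -> f i = a) -> \sum_i f i = f k + (q%:R - 1) * a.
Proof.
move=> fa; transitivity (\sum_(i < q) a + \sum_i (f k - a) * (i == k)%:R).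
  rewrite -big_split /=; apply: eq_bigr => i _.
  by have [->|ik] := eqVneq i k; rewrite ?mulr1 ?subrKC // mulr0 addr0 fa.
rewrite sum_delta sumr_const card_ord mulrBl mul1r mulr_natl.
by rewrite addrC -addrA; congr (_ + _); rewrite addrC.
Qed.

(** Test [macrostate_le] in the direction (q - 1, -1, ..., -1), scaled so that the exponents at [k]
    and elsewhere differ by y, then multiply by exp(y/q). *)
Lemma macrostate_bernoulli_le (R : realType) (q : nat) (beta : R) (x : 'rV[R]_q)
    (k : 'I_q) (u : R) : 0 < beta -> macrostates q beta x ->
  (forall i, i != k -> x 0 i = u) -> forall y,
  1 - x 0 k + x 0 k * expR y <=
    expR (x 0 k * y + (q%:R - 1) / (2 * beta * q%:R) / 2 * y ^+ 2).
Proof.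
move=> b0 xM xu y; have q0 : (0 < q)%N by rewrite (leq_ltn_trans _ (ltn_ord k)).
have qn : (q%:R : R) != 0 by rewrite pnatr_eq0 -lt0n.
have bn : beta != 0 by rewrite gt_eqF.
pose t := y / (2 * beta * q%:R).
pose s i := if i == k then (q%:R - 1) * t else - t.
have sk : s k = (q%:R - 1) * t by rewrite /s eqxx.
have su i : i != k -> s i = - t by move=> /negPf; rewrite /s => ->.
have := macrostate_sum1 _ _ _ _ q0 b0 xM; rewrite (sum_one_special _ _ k _ u) // => x1.
have := macrostate_le R q beta x s q0 b0 xM.
rewrite (sum_one_special _ _ k _ (u * expR (2 * beta * - t))); last first.
  by move=> i ik; rewrite su // xu.
rewrite (sum_one_special _ _ k (fun i => x 0 i * s i) (u * - t)); last first.
  by move=> i ik; rewrite su // xu.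
rewrite (sum_one_special _ _ k (fun i => s i ^+ 2) ((- t) ^+ 2)); last first.
  by move=> i ik; rewrite su.
have uE : (q%:R - 1) * u = 1 - x 0 k by lra.
have -> : 2 * beta * s k = y - y / q%:R by rewrite sk /t; field; rewrite qn bn.
have -> : 2 * beta * - t = - (y / q%:R) by rewrite /t; field; rewrite qn bn.
rewrite !(mulrA (q%:R - 1)) uE => le.
have e1 : expR (- (y / q%:R)) * expR (y / q%:R) = 1 by rewrite -expRD addNr expR0.
have -> : 1 - x 0 k + x 0 k * expR y = (x 0 k * expR (y - y / q%:R) +
    (1 - x 0 k) * expR (- (y / q%:R))) * expR (y / q%:R).
  rewrite expRD mulrDl -(mulrA _ _ (expR (y / q%:R))) -(mulrA (expR y)).
  by rewrite -(mulrA _ _ (expR (y / q%:R))) e1; ring.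
apply: le_trans (ler_wpM2r (expR_ge0 _) le) _.
rewrite -expRD le_eqVlt; apply/orP; left; apply/eqP; congr expR.
by rewrite sk /t; field; rewrite qn bn.
Qed.

(** The last clause of [macrostate_value] amounts to v(1 - v) < K, which [bernoulli_variance_lt]
    gives unless v = 1/2. For v = 1/2 the two sides of a contradiction are K >= 1/4 and K < 1/4. *)
Lemma macrostate_profile (R : realType) (q : nat) (beta : R) (x : 'rV[R]_q) :
  (3 <= q)%N -> 0 < beta -> macrostates q beta x ->
  exists k, macrostate_value q beta (x 0 k) /\
    forall i, i != k -> x 0 i = (1 - x 0 k) / (q%:R - 1).
Proof.
move=> q3 b0 xM; have q0 : (0 < q)%N by exact: ltn_trans q3.
have q3R : 3 <= q%:R :> R by rewrite ler_nat.
have q10 : 0 < q%:R - 1 :> R by lra.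
have qR0 : 0 < q%:R :> R by lra.
have [k [u [uk xu]]] := macrostate_shape _ _ _ _ q0 b0 xM.
have test := macrostate_bernoulli_le R q beta x k u b0 xM xu.
have x1 := macrostate_sum1 _ _ _ _ q0 b0 xM.
rewrite (sum_one_special _ _ k _ u) // in x1.
have [j jk] : exists j, j != k.
  have : (1 < #|'I_q|)%N by rewrite card_ord ltnW.
  rewrite (cardD1 k) inE ltnS => /card_gt0P[j]; rewrite !inE andbT => jk.
  by exists j.
have v0 := macrostate_gt0 _ _ _ _ q0 b0 xM k.
have u0 : 0 < u by rewrite -(xu j jk) (macrostate_gt0 _ _ _ _ q0 b0 xM).
have xln := macrostate_ln _ _ _ _ q0 b0 xM k j; rewrite (xu j jk) in xln.
set v := x 0 k in uk test x1 v0 xln *.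
have uE : u = (1 - v) / (q%:R - 1) by apply: (canRL (mulfK (lt0r_neq0 q10))); lra.
have v1 : v < 1.
  by have := mulr_gt0 q10 u0; lra.
have qv : q%:R^-1 <= v.
  rewrite -(ler_pM2l qR0) divff ?gt_eqF //.
  have : (q%:R - 1) * u <= (q%:R - 1) * v by rewrite ler_pM2l.
  lra.
exists k; split; last by move=> i ik; rewrite xu.
split=> //; first by rewrite -uE.
rewrite -uE.
pose K := (q%:R - 1) / (2 * beta * q%:R).
suff : v * (1 - v) < K.
  have bq0 : 0 < 2 * beta * q%:R by rewrite !mulr_gt0.
  rewrite /K ltr_pdivlMr // => lt; rewrite -(ltr_pM2l q10) mulr1.
  apply: le_lt_trans lt; rewrite le_eqVlt; apply/orP; left; apply/eqP.
  have -> : 1 - v = (q%:R - 1) * u by lra.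
  by rewrite -/v; ring.
have [v2|v2] := eqVneq v (1 / 2); last first.
  by apply: bernoulli_variance_lt => //; rewrite v0.
have K0 : 0 <= K by rewrite divr_ge0 ?mulr_ge0 // ltW.
(* With v = 1/2, recentring the Bernoulli bound gives a cosh bound and K >= 1/4. Criticality gives
   ln w = beta (w - 1)/w with w = q - 1 > 1, and [ln_gt_rational] turns this into K < 1/4. *)
have /lt_geF : K < 1 / 4; last first.
  have : 1 / 2 <= 2 * K.
    apply: cosh_second_order => [|y y0]; first by rewrite mulr_ge0.
    have := test (2 * y); rewrite -/K v2 => le.
    have := ler_wpM2r (expR_ge0 (- y)) le.
    rewrite -expRD.
    have -> : 1 / 2 * (2 * y) + K / 2 * (2 * y) ^+ 2 - y = 2 * K * y ^+ 2 by field.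
    have -> : 2 * y = y + y by lra.
    rewrite expRD.
    have -> : (1 - 1 / 2 + 1 / 2 * (expR y * expR y)) * expR (- y) =
       1 / 2 * expR (- y) + 1 / 2 * expR y * (expR y * expR (- y)) by field.
    rewrite -expRD subrr expR0; lra.
  by move=> ? /negbT; rewrite -ltNge; lra.
have w1 : 1 < (q%:R - 1 : R) by lra.
have := ln_gt_rational R _ w1; set w := q%:R - 1 in w1 q10 x1 uE *.
have qE : q%:R = w + 1 by rewrite /w; lra.
have lnE : ln w = beta * (w - 1) / w.
  have u2 : u = (1 / 2) / w by rewrite uE v2; congr (_ / _); lra.
  have lnh : ln (1 / 2 / w) = ln (1 / 2) - ln w.
    by rewrite [LHS]lnM ?posrE ?invr_gt0 // [X in _ + X]lnV ?posrE.
  have -> : beta * (w - 1) / w = 2 * beta * (1 / 2 - 1 / 2 / w).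
    by field; rewrite gt_eqF.
  by rewrite -u2 -v2 -xln v2 u2 lnh; ring.
have d0 : 0 < 2 * beta * (w + 1).
  by apply: mulr_gt0; [exact: mulr_gt0|lra].
rewrite lnE => lt; rewrite /K -/w qE ltr_pdivrMr //.
have w10 : 0 < w - 1 by lra.
have := lt; have -> : (w + 1) * (beta * (w - 1) / w) = (w - 1) * ((w + 1) * beta / w).
  by field; rewrite gt_eqF.
rewrite (mulrC 2) ltr_pM2l // ltr_pdivlMr //; lra.
Qed.

                                                                                
                                                                                 
(** * Uniform spectral gap at the macrostates *)

(** Criticality puts v on the line of slope 1/K through the point of the logit graph at 1/q. With v
    and v' both on it, [logit_two_chords] gives v(1 - v) > K, against the second-order condition at
    v. *)
Lemma macrostate_value_unique (R : realType) (q : nat) (beta v v' : R) :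
  (3 <= q)%N -> 0 < beta -> macrostate_value q beta v ->
  macrostate_value q beta v' -> q%:R^-1 < v -> v < v' -> False.
Proof.
move=> q3 b0 [_ v1 E C] [_ v'1 E' C'] qv vv'.
have q3R : 3 <= q%:R :> R by rewrite ler_nat.
have q10 : 0 < q%:R - 1 :> R by lra.
have qR0 : 0 < q%:R :> R by lra.
have qn : (q%:R : R) != 0 by rewrite gt_eqF.
have q1n : (q%:R - 1 : R) != 0 by rewrite gt_eqF.
have bn : beta != 0 by rewrite gt_eqF.
have p0 : 0 < q%:R^-1 :> R by rewrite invr_gt0.
have v0 := lt_trans p0 qv; have v'0 := lt_trans v0 vv'.
pose K := (q%:R - 1) / (2 * beta * q%:R).
have bq0 : 0 < 2 * beta * q%:R by rewrite !mulr_gt0.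
have lnp : ln (q%:R^-1) - ln (1 - q%:R^-1) = - ln (q%:R - 1 : R).
  have -> : 1 - q%:R^-1 = (q%:R - 1) / q%:R :> R by field.
  by rewrite lnM ?posrE // lnV ?posrE //; ring.
have lnv (t : R) : t < 1 ->
    ln ((1 - t) / (q%:R - 1)) = ln (1 - t) - ln (q%:R - 1).
  rewrite -subr_gt0 => t10.
  by rewrite lnM ?posrE ?invr_gt0 // lnV ?posrE.
have chord (t : R) : 2 * beta * (t - (1 - t) / (q%:R - 1)) = (t - q%:R^-1) / K.
  by rewrite /K; field; rewrite qn q1n bn.
rewrite lnv // chord in E; rewrite lnv // chord in E'.
have : K < v * (1 - v).
  apply: (logit_two_chords _ q%:R^-1 v v' K) => //; first by rewrite divr_gt0.
    by rewrite -E lnp; ring.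
  have -> : (v' - v) / K = (v' - q%:R^-1) / K - (v - q%:R^-1) / K by ring.
  by rewrite -E -E'; ring.
rewrite ltNge => /negP; apply; rewrite /K ler_pdivlMr //.
have := C; rewrite mulrA ltr_pdivrMr // mul1r; lra.
Qed.

(** There are at most two admissible values, 1/q and one larger, so c is the smaller of two positive
    gaps; a value that does not occur gets the gap 1. *)
Lemma macrostate_value_gap (R : realType) (q : nat) (beta : R) :
  (3 <= q)%N -> 0 < beta -> exists2 c : R, 0 < c <= 1 &
  forall v, macrostate_value q beta v ->
    2 * beta * q%:R * v * ((1 - v) / (q%:R - 1)) <= 1 - c.
Proof.
move=> q3 b0; pose f (v : R) := 2 * beta * q%:R * v * ((1 - v) / (q%:R - 1)).
have q3R : 3 <= q%:R :> R by rewrite ler_nat.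
have f0 v : macrostate_value q beta v -> 0 <= f v.
  move=> [qv v1 _ _]; have v0 : 0 <= v by rewrite (le_trans _ qv) // invr_ge0.
  have [v10 q10] : 0 <= 1 - v /\ 0 <= q%:R - 1 :> R by split; lra.
  apply: mulr_ge0; last exact: divr_ge0.
  by rewrite !mulr_ge0 // ltW.
have gap v : macrostate_value q beta v -> 0 < 1 - f v <= 1.
  by move=> vM; have [_ _ _ lt] := vM; rewrite subr_gt0 lt gerBl f0.
pose P v := macrostate_value q beta v /\ q%:R^-1 < v.
have [c1 c1I c1P] : exists2 c : R, 0 < c <= 1 &
    macrostate_value q beta q%:R^-1 -> f q%:R^-1 <= 1 - c.
  have [vM|nvM] := pselect (macrostate_value q beta (q%:R^-1 : R)).
    by exists (1 - f q%:R^-1); [exact: gap|rewrite opprB addrC subrK].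
  by exists 1 => //; rewrite ltr01 lexx.
have [c2 c2I c2P] : exists2 c : R, 0 < c <= 1 & forall v, P v -> f v <= 1 - c.
  have [[v [vM qv]]|none] := pselect (exists v, P v); last first.
    by exists 1 => [|v Pv]; [rewrite ltr01 lexx|case: none; exists v].
  exists (1 - f v) => [|v' [v'M qv']]; first exact: gap.
  have [vv'|vv'|->] := ltgtP v v'.
  - by have := macrostate_value_unique _ _ _ _ _ q3 b0 vM v'M qv vv'.
  - by have := macrostate_value_unique _ _ _ _ _ q3 b0 v'M vM qv' vv'.
  - by rewrite opprB addrC subrK.
move: c1I c2I => /andP[c10 c11] /andP[c20 c21].
exists (Num.min c1 c2) => [|v vM]; first by rewrite lt_min c10 c20 ge_min c11.
rewrite -/(f v); have [qv|] := ltP q%:R^-1 v.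
  by rewrite (le_trans (c2P v (conj vM qv))) // lerD2l lerN2 ge_min lexx orbT.
have [qv _ _ _] := vM => vq; have e : v = q%:R^-1 by apply/eqP; rewrite eq_le vq.
by rewrite e (le_trans (c1P _)) -?e // lerD2l lerN2 ge_min lexx.
Qed.

(** Since x is constant off [k], both moments reduce to |d|^2 and d_k, with a nonnegative
    coefficient at d_k^2; for d of sum zero, d_k^2 is at most (q - 1)/q times |d|^2. *)
Lemma variance_le (R : realType) (q : nat) (x : 'rV[R]_q) (k : 'I_q)
    (d : 'I_q -> R) : (1 < q)%N -> q%:R^-1 <= x 0 k -> x 0 k < 1 ->
  (forall i, i != k -> x 0 i = (1 - x 0 k) / (q%:R - 1)) ->
  \sum_i d i = 0 ->
  \sum_i x 0 i * d i ^+ 2 - (\sum_i x 0 i * d i) ^+ 2 <=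
  q%:R * x 0 k * ((1 - x 0 k) / (q%:R - 1)) * \sum_i d i ^+ 2.
Proof.
move=> q1; set v := x 0 k; set u := (1 - v) / _ => qv v1 xu d0.
have q2R : 2 <= q%:R :> R by rewrite ler_nat.
have q10 : 0 < q%:R - 1 :> R by lra.
have qR0 : 0 < q%:R :> R by lra.
have qn : (q%:R : R) != 0 by rewrite gt_eqF.
have q1n : (q%:R - 1 : R) != 0 by rewrite gt_eqF.
set Q := \sum_i d i ^+ 2.
have wE (f : 'I_q -> R) : \sum_i x 0 i * f i = u * (\sum_i f i) + (v - u) * f k.
  rewrite mulr_sumr -(sum_delta _ _ (fun i => (v - u) * f i) k) -big_split /=.
  apply: eq_bigr => i _; have [->|ik] := eqVneq i k; first by rewrite mulr1 -/v; ring.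
  by rewrite xu // mulr0 addr0.
rewrite !wE d0 mulr0 add0r -/Q.
have dk : d k ^+ 2 <= Q * (q%:R - 1) / q%:R.
  (* -a is the mean of the other coordinates; centring them makes the dropped squares as small as
     possible, which yields the sharp constant. *)
  pose a := d k / (q%:R - 1).
  have : (d k + a) ^+ 2 <= Q + q%:R * a ^+ 2.
    have -> : Q + q%:R * a ^+ 2 = \sum_i (d i + a) ^+ 2.
      have -> : \sum_i (d i + a) ^+ 2 =
          \sum_i d i ^+ 2 + 2 * a * (\sum_i d i) + \sum_(i < q) a ^+ 2.
        by rewrite mulr_sumr -!big_split /=; apply: eq_bigr => i _; ring.
      by rewrite d0 mulr0 addr0 sumr_const card_ord mulr_natl.
    by rewrite [leRHS](bigD1 k) //= lerDl sumr_ge0 // => i _; exact: sqr_ge0.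
  rewrite -subr_ge0.
  have -> : Q + q%:R * a ^+ 2 - (d k + a) ^+ 2 =
      (Q * (q%:R - 1) / q%:R - d k ^+ 2) * (q%:R / (q%:R - 1)).
    by rewrite /a; field; rewrite qn q1n.
  by rewrite pmulr_lge0 ?divr_gt0 // subr_ge0.
have uE : (q%:R - 1) * u = 1 - v by rewrite /u mulrC divfK.
have qv1 : 1 <= q%:R * v by rewrite -ler_pdivrMl // mulr1.
have u0 : 0 < u by rewrite divr_gt0 // subr_gt0.
have uv : u <= v by rewrite /u ler_pdivrMr //; lra.
have -> : u * Q + (v - u) * d k ^+ 2 - ((v - u) * d k) ^+ 2 =
    u * Q + (v - u) * (1 - v + u) * d k ^+ 2 by ring.
have -> : q%:R * v * u * Q =
    u * Q + (v - u) * (1 - v + u) * (Q * (q%:R - 1) / q%:R).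
  by rewrite /u; field; rewrite qn q1n.
by rewrite lerD2l ler_wpM2l // mulr_ge0 ?subr_ge0 //; lra.
Qed.

(** The set contains 1/4, by exp(t) >= 1 + t, and is bounded above, so its supremum is a true one.
    Above the bound [B] the function is positive at 1/2 and negative at 1, so it has a zero in (1/q,
    1). *)
Lemma beta_s_gt0 (R : realType) (q : nat) : (3 <= q)%N -> 0 < beta_s R q.
Proof.
move=> q3; have q3R : 3 <= q%:R :> R by rewrite ler_nat.
have q10 : 0 < q%:R - 1 :> R by lra.
have q20 : 0 < q%:R - 2 :> R by lra.
have qR0 : 0 < q%:R :> R by lra.
have w0 : 0 <= ln (q%:R - 1) :> R by rewrite ln_ge0 //; lra.
pose g (beta x : R) := 1 + (q%:R - 1) * expR (2 * beta * ((1 - q%:R * x) / (q%:R - 1))).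
have g0 beta x : 0 < g beta x.
  by rewrite /g addr_gt0 // mulr_gt0 // expR_gt0.
apply: (@lt_le_trans _ _ (1 / 4)); first lra.
apply: ub_le_sup; last first.
  split=> [|x /andP[qx x1]]; first lra.
  rewrite subr_eq0 lt_eqF //.
  have x0 : 0 < x by rewrite (lt_trans _ qx) // invr_gt0.
  have qx1 : 1 < q%:R * x by rewrite mulrC -ltr_pdivrMr // mul1r.
  rewrite -/(g (1 / 4) x) -(ltr_pM2l (g0 (1 / 4) x)) divff ?gt_eqF //.
  have := expR_ge1Dx (2 * (1 / 4) * ((1 - q%:R * x) / (q%:R - 1))).
  rewrite -(ler_pM2l q10); set E := expR _ => le.
  have : (q%:R - 1) + (1 - q%:R * x) / 2 <= (q%:R - 1) * E.
    apply: le_trans le; rewrite le_eqVlt; apply/orP; left; apply/eqP.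
    by field; rewrite gt_eqF.
  rewrite -(ler_pM2r x0) => le'.
  rewrite /g -/E; have : 0 < (q%:R * x - 1) * (2 - x) by rewrite mulr_gt0; lra.
  lra.
(* This is the critical inverse temperature beta_c, at which x = 1/2 solves the equation exactly. *)
pose B : R := ln (q%:R - 1) * (q%:R - 1) / (q%:R - 2).
exists B => beta [b0 bP]; rewrite leNgt; apply/negP => Bb.
pose F x := (g beta x)^-1 - x.
have Fc : {within `[1 / 2, 1], continuous F}.
  have c : continuous (F : R^o -> R^o).
    move=> x; apply: (@continuousB _ R^o R^o (fun x => (g beta x)^-1) id) => //.
    apply: (@continuousV _ R^o (fun x => g beta x)); first by rewrite gt_eqF.
    rewrite /g; apply: (@continuousD _ R^o R^o (fun=> 1) _ x); first exact: cvg_cst.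
    apply: (@continuousM _ R^o (fun=> q%:R - 1) _ x); first exact: cvg_cst.
    apply: (@continuous_comp _ _ _ _ expR); last exact: continuous_expR.
    apply: (@continuousM _ R^o (fun=> 2 * beta) _ x); first exact: cvg_cst.
    apply: (@continuousM _ R^o _ (fun=> (q%:R - 1)^-1) x); last exact: cvg_cst.
    apply: (@continuousB _ R^o R^o (fun=> 1) _ x); first exact: cvg_cst.
    by apply: (@continuousM _ R^o (fun=> q%:R) id x) => //; exact: cvg_cst.
  exact: continuous_subspaceT.
have F1 : F 1 < 0.
  by rewrite /F subr_lt0 invf_lt1 // /g ltrDl mulr_gt0 // expR_gt0.
have F2 : 0 < F (1 / 2).
  have E : (q%:R - 1) * expR (2 * beta * ((1 - q%:R * (1 / 2)) / (q%:R - 1))) < 1.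
    rewrite -[X in X * _](lnK (x := q%:R - 1)) ?posrE // -expRD expR_lt1.
    move: Bb; rewrite /B ltr_pdivrMr // => lt.
    rewrite -(ltr_pM2r q10) mul0r mulrDl.
    have -> : 2 * beta * ((1 - q%:R * (1 / 2)) / (q%:R - 1)) * (q%:R - 1) =
      - (beta * (q%:R - 2)) by field; rewrite gt_eqF.
    lra.
  rewrite /F subr_gt0 -(ltr_pM2r (g0 beta (1 / 2))) mulVf ?gt_eqF //.
  by rewrite /g; lra.
have [|||x] := @IVT R F (1 / 2) 1 0.
- lra.
- exact: Fc.
- by rewrite ge_min le_max (ltW F1) (ltW F2) orbT.
rewrite in_itv /= => /andP[x2 x1] Fx.
have xn1 : x < 1.
  by rewrite lt_neqAle x1 andbT; apply/eqP => e; move: F1; rewrite -e Fx ltxx.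
have := bP x; rewrite xn1 andbT -/(g beta x) -/(F x) Fx eqxx.
have qx : q%:R^-1 < x.
  rewrite (lt_le_trans _ x2) // -(ltr_pM2l qR0) divff ?gt_eqF //; lra.
by move=> /(_ qx).
Qed.

Theorem theorem1p4 (R : realType) (q : nat) (beta : R) :
  (3 <= q)%N -> beta_s R q <= beta ->
  exists2 r0 : R, 0 < r0 &
  forall r : R, 0 < r < r0 ->
  exists2 theta : R, 0 < theta &
  forall x : 'rV[R]_q, macrostates q beta x ->
  forall N : nat, (0 < N)%N ->
  forall h : {sigma : config N q | sigma \in near_configs N x r} -> R,
    `| expect (conditional (potts beta) (near_configs N x r)) h
       - expect (conditional (product_measure x) (near_configs N x r)) h |
    <= lipschitz_sup h * theta * Num.sqrt N%:R.
Proof.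
move=> q3 bs; have q0 : (0 < q)%N by exact: ltn_trans q3.
have q1 : (1 < q)%N by exact: ltn_trans q3.
have b0 : 0 < beta by exact: lt_le_trans (beta_s_gt0 R q q3) bs.
have [c /andP[c0 c1] gap] := macrostate_value_gap R q beta q3 b0.
pose B := 2 * beta * (q%:R + 1) + 16 * beta ^+ 2.
have B0 : 0 < B.
  by apply: addr_gt0; rewrite ?mulr_gt0 ?exprn_gt0 // addr_gt0 // ltr0n.
(* The first bound keeps the exponents in the range of [expR_le_quadratic]; the second makes the
   cubic errors of [drift_le] at most c/2. *)
exists (Num.min (1 / (4 * beta)) (c / (2 * B))).
  by rewrite lt_min !divr_gt0 ?mulr_gt0.
move=> r /andP[r0]; rewrite lt_min => /andP[rb rB].
have {}rb : 2 * beta * r <= 1 / 2.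
  by move: rb; rewrite ltr_pdivlMr ?mulr_gt0 //; lra.
have {}rB : r * B <= c / 2.
  by move: rB; rewrite ltr_pdivlMr ?mulr_gt0 //; lra.
pose M := 2 * expR (2 * beta * r) / c.
have M0 : 0 <= M by rewrite divr_ge0 ?mulr_ge0 ?expR_ge0 // ltW.
have qR0 : 0 < q%:R :> R by rewrite ltr0n.
exists (q%:R + `|M|); first by rewrite ltr_wpDr.
move=> x xM N N0 h.
have x0 := macrostate_gt0 _ _ _ _ q0 b0 xM.
have x0' k : 0 <= x 0 k by exact: ltW.
have x1 := macrostate_sum1 _ _ _ _ q0 b0 xM.
have Z0 := sum_exp_gt0 R q (fun i => 2 * beta * x 0 i) q0.
have [C C0 pottsE] := potts_tilted_weight R N q x beta _ N0 Z0
  (macrostate_critical _ _ _ _ q0 b0 xM).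
have var (d : 'I_q -> R) : \sum_k d k = 0 ->
    2 * beta * (\sum_k x 0 k * d k ^+ 2 - (\sum_k x 0 k * d k) ^+ 2) <=
    (1 - c) * \sum_k d k ^+ 2.
  move=> d0; have [k [kM xk]] := macrostate_profile R q beta x q3 b0 xM.
  have [qk k1 _ _] := kM.
  have b20 : 0 <= 2 * beta by rewrite mulr_ge0 // ltW.
  apply: le_trans (ler_wpM2l b20 (variance_le R q x k d q1 qk k1 xk d0)) _.
  rewrite !mulrA ler_wpM2r //; last by rewrite -mulrA; exact: gap.
  by apply: sumr_ge0 => i _; exact: sqr_ge0.
have mom := sq_deviation_moment R N q x beta c r N0 x0' x1 (ltW b0) c0 (ltW r0) rb var rB.
(* For the product measure the tilt is 0, the variance condition holds because c <= 1, and the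
   resulting bound 2/c is at most [M]. *)
have mom0 : \sum_(sigma in near_configs N x r)
    tilted_weight x 0 sigma * (N%:R * sq_deviation x sigma) <=
    M * \sum_(sigma in near_configs N x r) tilted_weight x 0 sigma.
  apply: le_trans (sq_deviation_moment R N q x 0 c r N0 x0' x1 _ c0 (ltW r0) _ _ _) _ => //.
  - by rewrite mulr0 mul0r; lra.
  - move=> d _; rewrite mulr0 mul0r mulr_ge0 ?subr_ge0 // sumr_ge0 // => i _.
    exact: sqr_ge0.
  - by rewrite mulr0 mul0r expr0n mulr0 addr0 mulr0 divr_ge0 // ltW.
  rewrite ler_wpM2r ?sumr_ge0 // => [sigma _|]; first exact/ltW/tilted_weight_gt0.
  rewrite /M ler_wpM2r ?invr_ge0 ?(ltW c0) // ler_wpM2l // ler_expR.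
  by rewrite mulr0 mul0r !mulr_ge0 ?(ltW b0) ?(ltW r0).
(* Conditioning forgets constant factors, so both measures may be replaced by their tilted
   weights. *)
rewrite (expect_conditional_scale _ _ _ (tilted_weight x beta) _ h C) ?gt_eqF //.
rewrite (expect_conditional_scale _ _ (product_measure x) (tilted_weight x 0)
  _ h 1) ?oner_eq0 //; last first.
  by move=> sigma; rewrite mul1r tilted_weight0.
rewrite !expect_conditional.
apply: (mean_difference_le R N q x r _ _ _ _ M) => //; first exact: ltW.
- exact: lipschitz_sup_ge0.
- by move=> sigma v i; exact: lipschitz_supP.
- by move=> sigma; exact: tilted_weight_gt0.
- by move=> sigma; exact: tilted_weight_gt0.
- by move=> sigma p; exact: tilted_weight_shuffle.
- by move=> sigma p; exact: tilted_weight_shuffle.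
Qed.
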